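(* Let $\varphi:(M^2,g)\to (N^3,h)$ be an isometric immersion of a surface into a Riemannian 3-manifold which is totally umbilical, with unit normal vector field $\xi$, shape operator $A$ and mean curvature vector field $\eta=H\xi$, and let $f:M^2\to(0,+\infty)$ be a function. Then the conformal immersion $\varphi:(M^2,f^{-1}g)\to (N^3,h)$ is biharmonic if and only if one of the following cases happens: (i) the surface is totally geodesic; (ii) the surface has nonzero mean curvature $H$, and $f$ and $H$ satisfy $$(\mathrm{Ric}^N(\xi))^{\top}=\mathrm{grad}_g H,\qquad \mathrm{Ric}^N(\xi,\xi)=|A|^2=2H^2,\qquad \mathrm{grad}_g(fH)=0 .$$ In this case (ii), $f=c|H|^{-1}$ on the surface, where $c>0$ is a constant. Moreover, by the totally umbilical property of the surface, the first equation $(\mathrm{Ric}^N(\xi))^{\top}=\mathrm{grad}_g H$ holds automatically.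
   Context: Manifolds are smooth and connected. A smooth map $\varphi:(M,g)\to(N,h)$ is harmonic if its tension field $\tau(\varphi)=\mathrm{Trace}_g\nabla d\varphi$ vanishes identically, and biharmonic if $\tau_2(\varphi)=\mathrm{Trace}_g(\nabla^\varphi\nabla^\varphi-\nabla^\varphi_{\nabla^M})\tau(\varphi)-\mathrm{Trace}_g R^N(d\varphi,\tau(\varphi))d\varphi=0$, where $R^N(X,Y)Z=[\nabla^N_X,\nabla^N_Y]Z-\nabla^N_{[X,Y]}Z$. For a surface with unit normal $\xi$, the shape operator is $A(X)=-\nabla^N_X\xi$ and $H=\frac12\mathrm{trace}\,A$; the surface is totally umbilical if $A(X)=HX$ for all tangent $X$. $\mathrm{Ric}^N$ as an operator is defined by $\langle \mathrm{Ric}^N(Z),W\rangle=\mathrm{Ric}^N(Z,W)$, and $\top$ denotes the component tangent to the surface. Here $g=\varphi^*h$, and $\mathrm{grad}_g$ and norms are taken with respect to $g$; the conformal factor of $\varphi:(M^2,f^{-1}g)\to(N^3,h)$ is $\lambda=f^{1/2}$. *)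

(* Defs.v *)
From HB Require Import structures.
From mathcomp Require Import all_boot all_order all_algebra.
From mathcomp Require Import all_classical all_reals all_analysis.

Set Implicit Arguments.
Unset Strict Implicit.
Unset Printing Implicit Defensive.

Import Order.TTheory GRing.Theory Num.Theory.
Import numFieldNormedType.Exports.

Local Open Scope classical_set_scope.
Local Open Scope ring_scope.

(* Tangent vectors are given by their components in a chart, as row vectors;
   a linear map acts on them by multiplication on the right, so the Jacobian
   matrix 'J F x has entries ('J F x) i j = (d F^j / d x^i) (x). *)

Section SmoothFunctions.
Context {R : realType} {m : nat} {V : normedModType R}.

(* U is meant to be open. *)
Fixpoint Ck (k : nat) (U : set 'rV[R]_m) (F : 'rV[R]_m -> V) : Prop :=
  if k is k'.+1 then
    (forall x, U x -> differentiable F x) /\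
    (forall v : 'rV[R]_m, Ck k' U ('D_v F))
  else forall x, U x -> {for x, continuous F}.

Definition smooth_on (U : set 'rV[R]_m) (F : 'rV[R]_m -> V) : Prop :=
  forall k, Ck k U F.

End SmoothFunctions.

(* Geometry in coordinates: G : 'rV_n -> 'M_n is the matrix of a metric in a
   chart, and vector fields are functions of the coordinates. *)
Section LocalGeometry.
Context {R : realType}.

Definition basis_vec {n : nat} (i : 'I_n) : 'rV[R]_n := delta_mx 0 i.

Definition christoffel {n : nat} (G : 'rV[R]_n -> 'M[R]_n) (x : 'rV[R]_n)
    (i j k : 'I_n) : R :=
  2^-1 * \sum_(l < n) invmx (G x) k l *
    ('D_(basis_vec i) (fun y => G y j l) x
     + 'D_(basis_vec j) (fun y => G y i l) x
     - 'D_(basis_vec l) (fun y => G y i j) x).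

Definition christoffel_vec {n : nat} (G : 'rV[R]_n -> 'M[R]_n)
    (x u v : 'rV[R]_n) : 'rV[R]_n :=
  \row_k \sum_(i < n) \sum_(j < n) u 0 i * v 0 j * christoffel G x i j k.

(* The pull-back by F of the Levi-Civita connection of G: the derivative in the
   direction of X of a vector field V along F. *)
Definition nabla_along {m n : nat} (G : 'rV[R]_n -> 'M[R]_n)
    (F : 'rV[R]_m -> 'rV[R]_n) (X : 'rV[R]_m -> 'rV[R]_m)
    (V : 'rV[R]_m -> 'rV[R]_n) (x : 'rV[R]_m) : 'rV[R]_n :=
  'D_(X x) V x + christoffel_vec G (F x) ('D_(X x) F x) (V x).

Definition levi_civita {n : nat} (G : 'rV[R]_n -> 'M[R]_n)
    (X Y : 'rV[R]_n -> 'rV[R]_n) : 'rV[R]_n -> 'rV[R]_n :=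
  nabla_along G id X Y.

Definition lie_bracket {n : nat} (X Y : 'rV[R]_n -> 'rV[R]_n)
    (x : 'rV[R]_n) : 'rV[R]_n :=
  'D_(X x) Y x - 'D_(Y x) X x.

Definition curvature {n : nat} (G : 'rV[R]_n -> 'M[R]_n)
    (X Y Z : 'rV[R]_n -> 'rV[R]_n) (x : 'rV[R]_n) : 'rV[R]_n :=
  levi_civita G X (levi_civita G Y Z) x
  - levi_civita G Y (levi_civita G X Z) x
  - levi_civita G (lie_bracket X Y) Z x.

(* R(u, v) w for vectors at x; the curvature being a tensor, it is computed on
   the extensions of u, v, w with constant components. *)
Definition riemann {n : nat} (G : 'rV[R]_n -> 'M[R]_n) (x u v w : 'rV[R]_n) :
    'rV[R]_n :=
  curvature G (cst u) (cst v) (cst w) x.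

(* Ric(z, w) is the trace of u |-> R(u, z) w. *)
Definition ricci {n : nat} (G : 'rV[R]_n -> 'M[R]_n) (x z w : 'rV[R]_n) : R :=
  \sum_(i < n) riemann G x (basis_vec i) z w 0 i.

Definition ricci_op {n : nat} (G : 'rV[R]_n -> 'M[R]_n) (x z : 'rV[R]_n) :
    'rV[R]_n :=
  (\row_j ricci G x z (basis_vec j)) *m invmx (G x).

Definition inner {n : nat} (B : 'M[R]_n) (u v : 'rV[R]_n) : R :=
  (u *m B *m v^T) 0 0.

Definition grad {n : nat} (G : 'rV[R]_n -> 'M[R]_n) (u : 'rV[R]_n -> R)
    (x : 'rV[R]_n) : 'rV[R]_n :=
  (\row_i 'D_(basis_vec i) u x) *m invmx (G x).

(* (nabla dF)(X, Y), for the metrics G on the source and K on the target *)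
Definition second_fundamental_form {m n : nat} (G : 'rV[R]_m -> 'M[R]_m)
    (K : 'rV[R]_n -> 'M[R]_n) (F : 'rV[R]_m -> 'rV[R]_n)
    (X Y : 'rV[R]_m -> 'rV[R]_m) (x : 'rV[R]_m) : 'rV[R]_n :=
  nabla_along K F X (fun y => 'D_(Y y) F y) x
  - 'D_(levi_civita G X Y x) F x.

Definition trace_metric {m n : nat} (B : 'M[R]_m)
    (T : 'I_m -> 'I_m -> 'rV[R]_n) : 'rV[R]_n :=
  \sum_(i < m) \sum_(j < m) invmx B i j *: T i j.

Definition tension {m n : nat} (G : 'rV[R]_m -> 'M[R]_m)
    (K : 'rV[R]_n -> 'M[R]_n) (F : 'rV[R]_m -> 'rV[R]_n) (x : 'rV[R]_m) :
    'rV[R]_n :=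
  trace_metric (G x) (fun i j =>
    second_fundamental_form G K F (cst (basis_vec i)) (cst (basis_vec j)) x).

Definition bitension {m n : nat} (G : 'rV[R]_m -> 'M[R]_m)
    (K : 'rV[R]_n -> 'M[R]_n) (F : 'rV[R]_m -> 'rV[R]_n) (x : 'rV[R]_m) :
    'rV[R]_n :=
  let tau := tension G K F in
  trace_metric (G x) (fun i j =>
    let ei := cst (basis_vec i) in let ej := cst (basis_vec j) in
    nabla_along K F ei (nabla_along K F ej tau) x
    - nabla_along K F (levi_civita G ei ej) tau x)
  - trace_metric (G x) (fun i j =>
      riemann K (F x) ('D_(basis_vec i) F x) (tau x) ('D_(basis_vec j) F x)).

(* The component tangent to the image of dF (with matrix J) of the vector w of
   the target: the vector X of the source such that inner B X Y =
   inner C w (Y *m J) for all Y, where B and C are the matrices of the source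
   and target metrics at the point. *)
Definition tangent_part {m n : nat} (B : 'M[R]_m) (C : 'M[R]_n)
    (J : 'M[R]_(m, n)) (w : 'rV[R]_n) : 'rV[R]_m :=
  w *m C *m J^T *m invmx B.

(* The squared norm of the endomorphism X |-> X *m A for the inner product B,
   i.e. the sum of |A(e_i)|^2 over an orthonormal basis. *)
Definition norm_sq_op {m : nat} (B A : 'M[R]_m) : R :=
  \tr (invmx B *m A *m B *m A^T).

End LocalGeometry.

(* The smooth structure is given by an atlas, not necessarily maximal;
   chart_inv c is the inverse of chart_map c, with irrelevant values outside
   the image of the chart. *)
Record manifold (R : realType) (n : nat) := Manifold {
  carrier :> topologicalType;
  charts : Type;
  chart_dom : charts -> set carrier;
  chart_map : charts -> carrier -> 'rV[R]_n;
  chart_inv : charts -> 'rV[R]_n -> carrier;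
  chart_at : carrier -> charts;
  chart_atP : forall p, chart_dom (chart_at p) p;
  chart_dom_open : forall c, open (chart_dom c);
  chart_image_open : forall c, open (chart_map c @` chart_dom c);
  chart_mapK : forall c p, chart_dom c p -> chart_inv c (chart_map c p) = p;
  chart_map_continuous : forall c,
    {within chart_dom c, continuous (chart_map c)};
  chart_inv_continuous : forall c,
    {within chart_map c @` chart_dom c, continuous (chart_inv c)};
  transition_smooth : forall c c',
    smooth_on (chart_map c @` (chart_dom c `&` chart_dom c'))
      (chart_map c' \o chart_inv c);
  manifold_hausdorff : hausdorff_space carrier;
  manifold_second_countable : @second_countable carrier;
  manifold_connected : connected [set: carrier]
}.

Arguments charts {R n} _.
Arguments chart_dom {R n _} _ _.
Arguments chart_map {R n _} _ _.
Arguments chart_inv {R n _} _ _.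
Arguments chart_at {R n _} _.

Section Manifolds.
Context {R : realType} {m n : nat} (M : manifold R m) (N : manifold R n).

Definition transition_jac (c c' : charts M) (p : M) : 'M[R]_m :=
  'J (chart_map c' \o chart_inv c) (chart_map c p).

Definition smooth_fun (u : M -> R) : Prop :=
  forall c : charts M,
    smooth_on (chart_map c @` chart_dom c) (u \o chart_inv c : 'rV[R]_m -> R^o).

(* A field of bilinear forms: g c x is the matrix of the form at the point
   chart_inv c x, in the basis of coordinate vectors of c. *)
Definition metric_field : Type := charts M -> 'rV[R]_m -> 'M[R]_m.

Definition riemannian (g : metric_field) : Prop :=
  [/\ forall c, smooth_on (chart_map c @` chart_dom c) (g c),
      forall c x, (chart_map c @` chart_dom c) x -> (g c x)^T = g c x,
      forall c x, (chart_map c @` chart_dom c) x ->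
        forall v, v != 0 -> 0 < inner (g c x) v v &
      forall c c' p, chart_dom c p -> chart_dom c' p ->
        g c (chart_map c p) =
        transition_jac c c' p *m g c' (chart_map c' p)
          *m (transition_jac c c' p)^T].

(* The metric u^-1 g *)
Definition conformal_metric (u : M -> R) (g : metric_field) : metric_field :=
  fun c x => (u (chart_inv c x))^-1 *: g c x.

(* A c x is the matrix of an endomorphism X |-> X *m A c x of the tangent space
   at chart_inv c x. *)
Definition endo_field : Type := charts M -> 'rV[R]_m -> 'M[R]_m.

Definition is_endo_field (A : endo_field) : Prop :=
  forall c c' p, chart_dom c p -> chart_dom c' p ->
    A c (chart_map c p) *m transition_jac c c' p =
    transition_jac c c' p *m A c' (chart_map c' p).

(* The points of the chart c which phi maps to the chart d, in coordinates, and
   the expression of phi in these charts *)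
Definition loc_dom (phi : M -> N) (c : charts M) (d : charts N) :
    set 'rV[R]_m :=
  chart_map c @` (chart_dom c `&` phi @^-1` chart_dom d).

Definition loc (phi : M -> N) (c : charts M) (d : charts N) :
    'rV[R]_m -> 'rV[R]_n :=
  chart_map d \o phi \o chart_inv c.

Definition smooth_map (phi : M -> N) : Prop :=
  continuous phi /\ forall c d, smooth_on (loc_dom phi c d) (loc phi c d).

End Manifolds.

Section Maps.
Context {R : realType} {m n : nat} {M : manifold R m} {N : manifold R n}.

Definition isometric_immersion (g : metric_field M) (h : metric_field N)
    (phi : M -> N) : Prop :=
  smooth_map phi /\
  forall c d x, loc_dom phi c d x ->
    row_free ('J (loc phi c d) x) /\
    g c x = 'J (loc phi c d) x *m h d (loc phi c d x)
              *m ('J (loc phi c d) x)^T.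

Definition biharmonic (g : metric_field M) (h : metric_field N)
    (phi : M -> N) : Prop :=
  forall c d x, loc_dom phi c d x ->
    bitension (g c) (h d) (loc phi c d) x = 0.

Definition totally_geodesic (g : metric_field M) (h : metric_field N)
    (phi : M -> N) : Prop :=
  forall c d x, loc_dom phi c d x -> forall X Y : 'rV[R]_m,
    second_fundamental_form (g c) (h d) (loc phi c d) (cst X) (cst Y) x = 0.

(* xi d p lists the components in the chart d of a vector tangent to N at
   phi p. *)
Definition vector_along (phi : M -> N) (xi : charts N -> M -> 'rV[R]_n) :
    Prop :=
  (forall d d' p, chart_dom d (phi p) -> chart_dom d' (phi p) ->
     xi d' p = xi d p *m transition_jac d d' (phi p)) /\
  (forall c d, smooth_on (loc_dom phi c d) (xi d \o chart_inv c)).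

Definition unit_normal (h : metric_field N) (phi : M -> N)
    (xi : charts N -> M -> 'rV[R]_n) : Prop :=
  vector_along phi xi /\
  forall (c : charts M) (d : charts N) x, loc_dom phi c d x ->
    inner (h d (loc phi c d x)) (xi d (chart_inv c x)) (xi d (chart_inv c x))
      = 1 /\
    forall X : 'rV[R]_m,
      inner (h d (loc phi c d x)) (xi d (chart_inv c x)) (X *m 'J (loc phi c d) x)
      = 0.

(* dphi (A X) = - nabla^N_X xi *)
Definition shape_operator (h : metric_field N) (phi : M -> N)
    (xi : charts N -> M -> 'rV[R]_n) (A : endo_field M) : Prop :=
  is_endo_field A /\
  forall c d x, loc_dom phi c d x -> forall X : 'rV[R]_m,
    X *m A c x *m 'J (loc phi c d) x =
    - nabla_along (h d) (loc phi c d) (cst X) (xi d \o chart_inv c) x.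

End Maps.

(* The trace does not depend on the chart used to compute it. *)
Definition mean_curvature {R : realType} {M : manifold R 2}
    (A : endo_field M) (p : M) : R :=
  2^-1 * \tr (A (chart_at p) (chart_map (chart_at p) p)).

Definition totally_umbilical {R : realType} {M : manifold R 2}
    (A : endo_field M) : Prop :=
  forall (c : charts M) x, (chart_map c @` chart_dom c) x ->
    forall X : 'rV[R]_2, X *m A c x = mean_curvature A (chart_inv c x) *: X.

(* Main.v *)
Require Import Defs.
From mathcomp Require Import all_boot all_order all_algebra.
From mathcomp Require Import all_classical all_reals all_analysis.
From mathcomp Require Import ring lra.
Import Order.TTheory GRing.Theory Num.Theory.
Import numFieldNormedType.Exports.
Local Open Scope classical_set_scope.
Local Open Scope ring_scope.

Set Implicit Arguments.
Unset Strict Implicit.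
Unset Printing Implicit Defensive.

(** In dimension two the tension field and the rough Laplacian are multiplied by
   f when g is replaced by f^-1 g, because the change of the Christoffel symbols
   is trace-free. Hence the tension field of the conformal immersion is u xi with
   u = 2 f H, and, since nabla_X xi = - H dphi(X) for a totally umbilical surface,
   the bitension field is f times

     (Delta u - 2 u H^2 + u Ric(xi, xi)) xi - 2 H dphi(grad u),

   where Codazzi's equation Ric(xi)^T = grad H cancels the terms u grad H.  The
   tangential part of the biharmonic equation thus says that (f H)^2 has zero
   gradient, so that it is constant as M is connected.  Either H vanishes
   identically, or f H is locally constant and nowhere zero, in which case the
   normal part reduces to Ric(xi, xi) = 2 H^2. *)

(** * Differentiation *)

(** The tangential equation is H grad(fH) = 0, which is silent about fH wherever H vanishes.
    Multiplied by f it controls the gradient of the square, so a single zero of H forces H = 0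
    everywhere. Only when H has no zero does grad(fH) itself vanish on open sets, and this is what
    removes Delta u, a second-order quantity, from the normal equation.

    H is given pointwise, as a trace in a chart chosen at each point, so its smoothness has to be
    recovered from nabla xi = - H dphi. Codazzi's equation needs no derivative of the shape
    operator: commuting covariant derivatives of xi along phi produces the ambient curvature
    directly. The traces in the bitension field run over the tangent plane only, yet they compute
    Ric(xi, .) in full, because the missing normal term contains R(xi, xi) = 0.

    The computations take place on the open sets where phi sends one chart of M into one chart of N;
    the conclusion is globalized only through connectedness. *)

Section Calculus.
Context {R : realType}.

(** The little-o expansion of [f] at [x] is also one of [g], being a local statement; uniqueness of
    the differential then identifies ['d g x] with ['d f x]. *)
Lemma near_eq_differentiable (V W : normedModType R) (f g : V -> W) (x : V) :
  (\near x, f x = g x) -> differentiable f x -> differentiable g x.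
Proof.
move=> fg df; have [dc dfE] := (diff_locallyP _ _).1 df.
have fgx : f x = g x := nbhs_singleton fg.
have gE : g \o shift x = cst (g x) + 'd f x +o_ 0 id.
  apply/eqaddoP => e e0; move/eqaddoP : dfE => /(_ e e0).
  move: fg; rewrite (near_shift 0 x) /= subr0.
  by apply: filterS2 => h /= fgh; rewrite !fctE /= fgh fgx.
apply/diff_locallyP; split.
  by rewrite (diff_unique dc gE).
by rewrite (diff_unique dc gE).
Qed.

Lemma near_open (T : topologicalType) (U : set T) (x : T) (P : T -> Prop) :
  open U -> U x -> (forall y, U y -> P y) -> \near x, P x.
Proof. by move=> oU Ux UP; near=> y; apply: UP; near: y; exact: open_nbhs_nbhs.
Unshelve. all: by end_near. Qed.

Lemma eq_open_derive (V W : normedModType R) (U : set V) (f g : V -> W) (x v : V) :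
  open U -> U x -> (forall y, U y -> f y = g y) -> 'D_v f x = 'D_v g x.
Proof.
move=> oU Ux fg; apply: near_eq_derive.
by apply: (near_open (P := fun y => f y = g y) oU Ux) => y Uy; exact: fg.
Qed.

Lemma differentiable_mxP (V : normedModType R) (p q : nat) (A : V -> 'M[R]_(p, q)) (x : V) :
  differentiable A x <-> forall i j, differentiable (fun y => A y i j : R^o) x.
Proof.
split=> [dA i j|dA].
  exact: (@differentiable_comp _ _ _ _ A (fun N : 'M[R]_(p, q) => N i j : R^o) x dA
    (differentiable_coord _ _ _)).
rewrite (_ : A = \sum_i \sum_j (fun y => A y i j *: delta_mx i j)).
  apply: differentiable_sum => i; apply: differentiable_sum => j.
  exact: differentiableZl.
apply/funext => y; rewrite fct_sumE [LHS]matrix_sum_delta.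
by apply: eq_bigr => i _; rewrite fct_sumE.
Qed.

Lemma derive_mxE (V : normedModType R) (p q : nat) (A : V -> 'M[R]_(p, q)) (x v : V) i j :
  differentiable A x -> 'D_v A x i j = 'D_v (fun y => A y i j : R^o) x.
Proof.
by move=> dA; rewrite derive_mx ?mxE //; exact: diff_derivable.
Qed.

Lemma derive_comp (V W Z : normedModType R) (F : V -> W) (h : W -> Z) (x v : V) :
  differentiable F x -> differentiable h (F x) ->
  'D_v (h \o F) x = 'D_('D_v F x) h (F x).
Proof.
move=> dF dh; rewrite !deriveE //; last exact: differentiable_comp.
by rewrite diff_comp.
Qed.

Lemma derive_linear (V W : normedModType R) (F : V -> W) (x u v : V) (a : R) :
  differentiable F x -> 'D_(a *: u + v) F x = a *: 'D_u F x + 'D_v F x.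
Proof. by move=> dF; rewrite !deriveE // linearP. Qed.

Lemma deriveMR (V : normedModType R) (f g : V -> R^o) (x v : V) :
  differentiable f x -> differentiable g x ->
  'D_v (fun y => f y * g y : R^o) x = f x * 'D_v g x + g x * 'D_v f x.
Proof.
move=> df dg; rewrite (_ : (fun y => _) = f * g) //.
by rewrite deriveM //; exact: diff_derivable.
Qed.

Lemma differentiableMR (V : normedModType R) (f g : V -> R^o) (x : V) :
  differentiable f x -> differentiable g x -> differentiable (fun y => f y * g y : R^o) x.
Proof. by move=> df dg; exact: differentiableM. Qed.

End Calculus.

(** * Smooth functions *)

Section Smoothness.
Context {R : realType} {m : nat}.
Implicit Types (U : set 'rV[R]_m) (k : nat).

(** On an open set the values determine the derivatives, so the irrelevant values of chart
    expressions outside their domain do no harm. *)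
Lemma Ck_eq (V : normedModType R) k U (F G : 'rV[R]_m -> V) :
  open U -> (forall y, U y -> F y = G y) -> Ck k U F -> Ck k U G.
Proof.
move=> oU; elim: k F G => [|k IH] F G FG /=.
  move=> cF x Ux; rewrite /prop_for /continuous_at -FG //.
  have nFG : {near x, F =1 G} := near_open oU Ux FG.
  exact: cvg_trans (near_eq_cvg nFG) (cF x Ux).
move=> [dF CF]; split=> [x Ux|v].
  apply: near_eq_differentiable (dF x Ux).
  exact: (near_open (P := fun y => F y = G y) oU Ux).
by apply: IH (CF v) => y Uy; exact: eq_open_derive FG.
Qed.

Lemma CkW (V : normedModType R) k U (F : 'rV[R]_m -> V) : Ck k.+1 U F -> Ck k U F.
Proof.
elim: k F => [|k IH] F [dF CF]; last by split=> // v; exact: IH.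
by move=> x Ux; exact: differentiable_continuous (dF x Ux).
Qed.

Lemma Ck_subset (V : normedModType R) k U U' (F : 'rV[R]_m -> V) :
  U `<=` U' -> Ck k U' F -> Ck k U F.
Proof.
move=> UU'; elim: k F => [|k IH] F /=; first by move=> cF x /UU'; exact: cF.
by move=> [dF CF]; split=> [x /UU'|v]; [exact: dF|exact: IH].
Qed.

Lemma Ck_cst (V : normedModType R) k U (a : V) : Ck k U (fun=> a).
Proof.
elim: k a => [|k IH] a /=; first by move=> x _; exact: cst_continuous.
split=> [x _|v]; first exact: (differentiable_cst a x).
by rewrite (_ : 'D_v _ = fun=> 0) //; apply/funext => y; exact: (derive_cst a y v).
Qed.

Lemma CkD (V : normedModType R) k U (F G : 'rV[R]_m -> V) :
  open U -> Ck k U F -> Ck k U G -> Ck k U (fun y => F y + G y).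
Proof.
move=> oU; elim: k F G => [|k IH] F G /=.
  by move=> cF cG x Ux; exact: (cvgD (cF x Ux) (cG x Ux)).
move=> [dF CF] [dG CG]; split=> [x Ux|v].
  by apply: differentiableD; [exact: dF|exact: dG].
apply: Ck_eq oU _ (IH _ _ (CF v) (CG v)) => y Uy.
by rewrite -deriveD //; apply: diff_derivable; [exact: dF|exact: dG].
Qed.

Lemma CkM k U (f g : 'rV[R]_m -> R^o) :
  open U -> Ck k U f -> Ck k U g -> Ck k U (fun y => f y * g y : R^o).
Proof.
move=> oU; elim: k f g => [|k IH] f g.
  by move=> cf cg x Ux; exact: (cvgM (cf x Ux) (cg x Ux)).
move=> Cf Cg; move: (Cf) (Cg) => [df Df] [dg Dg]; split=> [x Ux|v].
  by apply: differentiableMR; [exact: df|exact: dg].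
apply: Ck_eq oU _ (CkD oU (IH _ _ (CkW Cf) (Dg v)) (IH _ _ (CkW Cg) (Df v))) => y Uy.
by rewrite deriveMR //; [exact: df|exact: dg].
Qed.

Lemma CkN k U (f : 'rV[R]_m -> R^o) :
  open U -> Ck k U f -> Ck k U (fun y => - f y : R^o).
Proof.
move=> oU Cf; apply: Ck_eq oU _ (CkM oU (Ck_cst k U (-1 : R^o)) Cf) => y _.
by rewrite mulN1r.
Qed.

Lemma CkV k U (f : 'rV[R]_m -> R^o) :
  open U -> (forall y, U y -> f y != 0) -> Ck k U f -> Ck k U (fun y => (f y)^-1 : R^o).
Proof.
move=> oU f0; elim: k => [|k IH].
  by move=> cf x Ux; exact: (cvgV (f0 x Ux) (cf x Ux)).
move=> Cf; move: (Cf) => [df Df]; split=> [x Ux|v].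
  by apply: differentiableV; [exact: df|exact: f0].
have Ci := IH (CkW Cf).
apply: Ck_eq oU _ (CkN oU (CkM oU (CkM oU Ci Ci) (Df v))) => y Uy.
rewrite deriveV ?f0 //; last exact/diff_derivable/df.
by rewrite -[RHS]/(_ * _) mulNr expr2 invfM.
Qed.

Lemma Ck_sum k U (I : Type) (r : seq I) (F : I -> 'rV[R]_m -> R^o) :
  open U -> (forall i, Ck k U (F i)) -> Ck k U (fun y => \sum_(i <- r) F i y : R^o).
Proof.
move=> oU CF; elim: r => [|i r IH].
  by apply: Ck_eq oU _ (Ck_cst k U (0 : R^o)) => y _; rewrite big_nil.
by apply: Ck_eq oU _ (CkD oU (CF i) IH) => y _; rewrite big_cons.
Qed.

Lemma Ck_prod k U (I : Type) (r : seq I) (F : I -> 'rV[R]_m -> R^o) :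
  open U -> (forall i, Ck k U (F i)) -> Ck k U (fun y => \prod_(i <- r) F i y : R^o).
Proof.
move=> oU CF; elim: r => [|i r IH].
  by apply: Ck_eq oU _ (Ck_cst k U (1 : R^o)) => y _; rewrite big_nil.
by apply: Ck_eq oU _ (CkM oU (CF i) IH) => y _; rewrite big_cons.
Qed.

Lemma Ck_coord k U (p q : nat) (A : 'rV[R]_m -> 'M[R]_(p, q)) i j :
  open U -> Ck k U A -> Ck k U (fun y => A y i j : R^o).
Proof.
move=> oU; elim: k A => [|k IH] A.
  move=> cA x Ux.
  exact: (@continuous_comp _ _ _ A (fun N : 'M[R]_(p, q) => N i j) x (cA x Ux)
    (@coord_continuous _ _ _ _ _ _)).
move=> [dA DA]; split=> [x Ux|v]; first exact: ((differentiable_mxP A x).1 (dA x Ux) i j).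
by apply: Ck_eq oU _ (IH _ (DA v)) => y Uy; rewrite derive_mxE //; exact: dA.
Qed.

(** One order is lost because continuity of [A] is deduced from differentiability of its entries;
    for smooth functions the loss is harmless. *)
Lemma Ck_mx k U (p q : nat) (A : 'rV[R]_m -> 'M[R]_(p, q)) :
  open U -> (forall i j, Ck k.+1 U (fun y => A y i j : R^o)) -> Ck k U A.
Proof.
move=> oU; elim: k A => [|k IH] A CA.
  move=> x Ux; apply: differentiable_continuous.
  by apply/differentiable_mxP => i j; exact: (CA i j).1.
have dA x : U x -> differentiable A x.
  by move=> Ux; apply/differentiable_mxP => i j; exact: (CA i j).1.
split=> // v; apply: IH => i j.
have H : Ck k.+1 U ('D_v (fun y => A y i j : R^o)) := (CA i j).2 v.
apply: (Ck_eq oU _ H) => y Uy.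
by rewrite derive_mxE //; exact: dA.
Qed.

End Smoothness.

Lemma derive_basis (R : realType) (n : nat) (V : normedModType R)
    (h : 'rV[R]_n -> V) (x v : 'rV[R]_n) :
  differentiable h x -> 'D_v h x = \sum_k v 0 k *: 'D_(basis_vec k) h x.
Proof.
move=> dh; rewrite deriveE // [v in LHS]row_sum_delta linear_sum.
by apply: eq_bigr => k _; rewrite linearZ deriveE.
Qed.

(** In the chain rule the direction ['D_v F y] varies with [y]. Expanding it in the standard basis
    leaves only derivatives of [h] in fixed directions, to which the induction applies. *)
Lemma Ck_comp (R : realType) (m n k : nat) (U : set 'rV[R]_m) (W : set 'rV[R]_n)
    (F : 'rV[R]_m -> 'rV[R]_n) (h : 'rV[R]_n -> R^o) :
  open U -> (forall x, U x -> W (F x)) -> Ck k U F -> Ck k W h -> Ck k U (h \o F).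
Proof.
move=> oU UW; elim: k h => [|k IH] h.
  by move=> cF ch x Ux; apply: continuous_comp; [exact: cF|exact/ch/UW].
move=> CF [dh Dh]; move: (CF) => [dF DF]; split=> [x Ux|v].
  exact: (@differentiable_comp _ _ _ _ F h x (dF x Ux) (dh _ (UW x Ux))).
apply: Ck_eq oU _ (Ck_sum (index_enum 'I_n) oU
  (fun i => CkM oU (Ck_coord 0 i oU (DF v)) (IH _ (CkW CF) (Dh (basis_vec i))))) => y Uy.
rewrite (derive_comp _ (dF y Uy) (dh _ (UW y Uy))).
by rewrite [RHS](derive_basis _ (dh _ (UW y Uy))).
Qed.

Section SmoothOn.
Context {R : realType} {m : nat} {U : set 'rV[R]_m}.
Hypothesis oU : open U.

Lemma smooth_eq (V : normedModType R) (F G : 'rV[R]_m -> V) :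
  (forall y, U y -> F y = G y) -> smooth_on U F -> smooth_on U G.
Proof. by move=> FG sF k; exact: Ck_eq (sF k). Qed.

Lemma smooth_subset (V : normedModType R) (U' : set 'rV[R]_m) (F : 'rV[R]_m -> V) :
  U `<=` U' -> smooth_on U' F -> smooth_on U F.
Proof. by move=> UU' sF k; exact: Ck_subset (sF k). Qed.

Lemma smooth_differentiable (V : normedModType R) (F : 'rV[R]_m -> V) x :
  smooth_on U F -> U x -> differentiable F x.
Proof. by move=> sF; exact: (sF 1).1. Qed.

Lemma smooth_derive (V : normedModType R) (F : 'rV[R]_m -> V) v :
  smooth_on U F -> smooth_on U ('D_v F).
Proof. by move=> sF k; exact: (sF k.+1).2. Qed.

Lemma smooth_cst (V : normedModType R) (a : V) : smooth_on U (fun=> a).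
Proof. by move=> k; exact: Ck_cst. Qed.

Lemma smoothD (V : normedModType R) (F G : 'rV[R]_m -> V) :
  smooth_on U F -> smooth_on U G -> smooth_on U (fun y => F y + G y).
Proof. by move=> sF sG k; exact: CkD. Qed.

Lemma smoothM (f g : 'rV[R]_m -> R^o) :
  smooth_on U f -> smooth_on U g -> smooth_on U (fun y => f y * g y : R^o).
Proof. by move=> sf sg k; exact: CkM. Qed.

Lemma smoothN (f : 'rV[R]_m -> R^o) :
  smooth_on U f -> smooth_on U (fun y => - f y : R^o).
Proof. by move=> sf k; exact: CkN. Qed.

Lemma smoothV (f : 'rV[R]_m -> R^o) :
  (forall y, U y -> f y != 0) -> smooth_on U f -> smooth_on U (fun y => (f y)^-1 : R^o).
Proof. by move=> f0 sf k; exact: CkV. Qed.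

Lemma smooth_sum (I : Type) (r : seq I) (F : I -> 'rV[R]_m -> R^o) :
  (forall i, smooth_on U (F i)) -> smooth_on U (fun y => \sum_(i <- r) F i y : R^o).
Proof. by move=> sF k; apply: Ck_sum => // i; exact: sF. Qed.

Lemma smooth_mxP (p q : nat) (A : 'rV[R]_m -> 'M[R]_(p, q)) :
  smooth_on U A <-> forall i j, smooth_on U (fun y => A y i j : R^o).
Proof.
split=> [sA i j k|sA k]; first exact: Ck_coord (sA k).
by apply: Ck_mx => // i j; exact: sA.
Qed.

Lemma smooth_comp (n : nat) (W : set 'rV[R]_n)
    (F : 'rV[R]_m -> 'rV[R]_n) (h : 'rV[R]_n -> R^o) :
  (forall x, U x -> W (F x)) -> smooth_on U F -> smooth_on W h -> smooth_on U (h \o F).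
Proof. by move=> UW sF sh k; exact: Ck_comp UW (sF k) (sh k). Qed.

Lemma smooth_det (p : nat) (A : 'rV[R]_m -> 'M[R]_p) :
  smooth_on U A -> smooth_on U (fun y => \det (A y) : R^o).
Proof.
move=> sA; apply: smooth_sum => s; apply: smoothM; first exact: smooth_cst.
by move=> k; apply: Ck_prod => // i; move: k; exact: (smooth_mxP A).1.
Qed.

Lemma smooth_invmx (p : nat) (A : 'rV[R]_m -> 'M[R]_p) :
  (forall y, U y -> A y \in unitmx) -> smooth_on U A ->
  smooth_on U (fun y => invmx (A y)).
Proof.
move=> uA sA; apply/smooth_mxP => i j.
(* Cramer's rule. *)
apply: (@smooth_eq _ (fun y => (\det (A y))^-1 * cofactor (A y) j i : R^o)).
  by move=> y Uy; rewrite /invmx uA // !mxE.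
apply: smoothM.
  by apply: smoothV (smooth_det sA) => y /uA; rewrite unitmxE unitfE.
apply: smoothM; first exact: smooth_cst.
apply: smooth_det; apply/smooth_mxP => a b.
apply: (@smooth_eq _ (fun y => A y (lift j a) (lift i b) : R^o)).
  by move=> y _; rewrite !mxE.
exact: (smooth_mxP A).1.
Qed.

Lemma smooth_inner (p : nat) (B : 'rV[R]_m -> 'M[R]_p) (u v : 'rV[R]_m -> 'rV[R]_p) :
  smooth_on U B -> smooth_on U u -> smooth_on U v ->
  smooth_on U (fun y => inner (B y) (u y) (v y) : R^o).
Proof.
move=> sB su sv.
apply: (@smooth_eq _ (fun y => \sum_j (\sum_i u y 0 i * B y i j) * v y 0 j : R^o)).
  move=> y _; rewrite /inner mxE; apply: eq_bigr => j _.
  by rewrite !mxE.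
apply: smooth_sum => j; apply: smoothM; last exact: (smooth_mxP v).1.
apply: smooth_sum => i; apply: smoothM; [exact: (smooth_mxP u).1|exact: (smooth_mxP B).1].
Qed.

End SmoothOn.

(** * Symmetry of second derivatives *)

Section MeanValue.
Context {R : realType} {V : normedModType R}.
Implicit Types (u : V -> R^o) (x v w : V).

Lemma is_derive_line u x v (s : R) :
  differentiable u (x + s *: v) ->
  is_derive s (1 : R) (fun r : R => u (x + r *: v) : R^o) ('D_v u (x + s *: v)).
Proof.
move=> du.
have E : (fun h : R => h^-1 *: (((fun r : R => u (x + r *: v) : R^o) \o shift s) (h *: (1 : R^o))
            - u (x + s *: v))) =
         (fun h : R => h^-1 *: ((u \o shift (x + s *: v)) (h *: v) - u (x + s *: v))).
  apply/funext => h /=; congr (_ *: (u _ - _)).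
  by rewrite [h *: 1]mulr1 scalerDl addrCA.
have du' := diff_derivable (v := v) du.
by split; rewrite /derivable /derive /= E.
Qed.

Lemma MVT_line u x v (t : R) :
  0 <= t -> (forall s, s \in `[0, t] -> differentiable u (x + s *: v)) ->
  exists2 s, s \in `[0, t] & u (x + t *: v) - u x = t * 'D_v u (x + s *: v).
Proof.
move=> t0 du.
have [||s st E] := @MVT_segment R (fun r => u (x + r *: v)) (fun r => 'D_v u (x + r *: v)) 0 t t0.
- by move=> s st; apply: is_derive_line; apply: du; exact: subset_itv_oo_cc st.
- apply: (@derivable_within_continuous R R^o) => s st.
  by have [] := is_derive_line (du _ st).
by exists s => //; rewrite scale0r addr0 subr0 in E; rewrite E mulrC.
Qed.

(** The mean value theorem is used twice: along [v] for the difference [u (y + t *: w) - u y], then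
    along [w] for ['D_v u]. *)
Lemma second_difference u x v w (t : R) :
  0 <= t ->
  (forall r s, r \in `[0, t] -> s \in `[0, t] ->
     differentiable u (x + r *: v + s *: w) /\
     differentiable ('D_v u) (x + r *: v + s *: w)) ->
  exists r s, [/\ r \in `[0, t], s \in `[0, t] &
    u (x + t *: v + t *: w) - u (x + t *: v) - u (x + t *: w) + u x =
    t * (t * 'D_w ('D_v u) (x + r *: v + s *: w))].
Proof.
move=> t0 du.
have t0I : 0 \in `[0, t] by rewrite in_itv /= lexx.
have ttI : t \in `[0, t] by rewrite in_itv /= t0 lexx.
pose phi y : R^o := u (y + t *: w) - u y.
have dsh y : differentiable (fun z => z + t *: w) y.
  by exact: (@differentiableD _ _ _ id (cst (t *: w))).
have Dsh y : 'D_v (fun z => z + t *: w) y = v.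
  rewrite [LHS](@deriveD _ _ _ id (cst (t *: w))); [|exact: derivable_id|exact: derivable_cst].
  by rewrite derive_id derive_cst addr0.
have dphi r : r \in `[0, t] -> differentiable phi (x + r *: v).
  move=> rI; apply: differentiableB.
    exact: (@differentiable_comp _ _ _ _ (fun z => z + t *: w) u _ (dsh _) (du _ _ rI ttI).1).
  by have := (du _ _ rI t0I).1; rewrite scale0r addr0.
have Dphi r : r \in `[0, t] ->
    'D_v phi (x + r *: v) = 'D_v u (x + r *: v + t *: w) - 'D_v u (x + r *: v).
  move=> rI.
  have d1 := (du _ _ rI ttI).1.
  have d2 : differentiable u (x + r *: v) by have := (du _ _ rI t0I).1; rewrite scale0r addr0.
  pose sh z := z + t *: w.
  have d3 : differentiable (u \o sh) (x + r *: v).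
    exact: (@differentiable_comp _ _ _ _ sh u _ (dsh _) d1).
  rewrite -[phi]/((u \o sh) - u) deriveB; [|exact: diff_derivable..].
  by rewrite (derive_comp v (dsh (x + r *: v)) d1) Dsh.
have [r rI E1] := MVT_line t0 dphi.
have [|s sI E2] := @MVT_line ('D_v u) (x + r *: v) w t t0.
  by move=> s sI; exact: (du _ _ rI sI).2.
exists r, s; split=> //; rewrite -E2 -Dphi // -E1 /phi.
by ring.
Qed.

Lemma near_values (U : set V) (a b : V -> R^o) x (e : R) :
  open U -> U x -> {for x, continuous a} -> {for x, continuous b} -> 0 < e ->
  exists2 r, 0 < r & forall y, ball x r y ->
    [/\ U y, `|a x - a y| < e & `|b x - b y| < e].
Proof.
move=> oU Ux /cvgrPdist_lt ca /cvgrPdist_lt cb e0.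
have /nbhs_ballP[r /= r0 rP] : \forall y \near x,
    [/\ U y, `|a x - a y| < e & `|b x - b y| < e].
  by near=> y; split; near: y; [exact: open_nbhs_nbhs|exact: ca|exact: cb].
by exists r.
Unshelve. all: by end_near. Qed.

Lemma dist_split (a b c e : R) : `|a - c| < e / 2 -> `|b - c| < e / 2 -> `|a - b| < e.
Proof.
move=> ac bc; rewrite (splitr e) -(subrKA c).
by rewrite (le_lt_trans (ler_normD _ _)) // ltrD // distrC.
Qed.

Theorem schwarz (U : set V) u x v w :
  open U -> U x ->
  (forall y, U y -> differentiable u y) ->
  (forall z y, U y -> differentiable ('D_z u) y) ->
  (forall z z' y, U y -> {for y, continuous ('D_z ('D_z' u))}) ->
  'D_v ('D_w u) x = 'D_w ('D_v u) x.
Proof.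
move=> oU Ux du ddu cddu; apply/eqP; rewrite -subr_eq0 -normr_le0.
apply/ler_addgt0Pr => e e0; rewrite add0r.
have e20 : 0 < e / 2 by rewrite divr_gt0.
have [r r0 rP] := near_values oU Ux (cddu v w x Ux) (cddu w v x Ux) e20.
(* The parallelogram of sides [t *: v] and [t *: w] must lie in the ball of radius [r]: this [t]
   bounds its extent by [r / 2], and the summand 1 keeps the denominator positive when both vectors
   vanish. *)
pose t := r / 2 / (1 + `|v| + `|w|).
have n0 : 0 < 1 + `|v| + `|w| by rewrite -addrA ltr_pwDl // addr_ge0.
have t0 : 0 < t by rewrite !divr_gt0.
have inB a b y z : a \in `[0, t] -> b \in `[0, t] -> `|y| + `|z| <= `|v| + `|w| ->
    ball x r (x + a *: y + b *: z).
  rewrite !in_itv /= => /andP[a0 at_] /andP[b0 bt] yz.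
  rewrite -ball_normE /= -addrA opprD addrA subrr add0r normrN.
  rewrite (le_lt_trans (ler_normD _ _)) // !normrZ !ger0_norm //.
  apply: (@le_lt_trans _ _ (t * (1 + `|v| + `|w|))).
    rewrite (@le_trans _ _ (t * (`|y| + `|z|))) //.
      by rewrite mulrDr lerD // ler_wpM2r.
    by rewrite ler_pM2l // (le_trans yz) // -addrA lerDr.
  by rewrite /t divfK ?gt_eqF // ltr_pdivrMr // ltr_pMr // ltr1n.
have [||a [b [aI bI E1]]] := @second_difference u x v w t; first exact: ltW.
  by move=> a b aI bI; have [Uab _ _] := rP _ (inB _ _ _ _ aI bI (lexx _)); split; [exact: du|exact: ddu].
have wv : `|w| + `|v| <= `|v| + `|w| by rewrite addrC.
have [||c [d [cI dI E2]]] := @second_difference u x w v t; first exact: ltW.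
  by move=> c d cI dI; have [Uab _ _] := rP _ (inB _ _ _ _ cI dI wv); split; [exact: du|exact: ddu].
(* The second difference is symmetric in [v] and [w], so both expressions equal it divided by the
   square of [t]. The two mixed derivatives thus agree at two points close to [x], and their
   continuity does the rest. *)
have E : 'D_w ('D_v u) (x + a *: v + b *: w) = 'D_v ('D_w u) (x + c *: w + d *: v).
  apply: (mulfI (lt0r_neq0 t0)); apply: (mulfI (lt0r_neq0 t0)).
  apply: etrans (esym E1) _; apply: etrans _ E2.
  by rewrite [x + t *: w + t *: v]addrAC; congr (_ + _); rewrite [LHS]addrAC.
have [_ _ B1] := rP _ (inB _ _ _ _ aI bI (lexx _)).
have [_ A1 _] := rP _ (inB _ _ _ _ cI dI wv).
rewrite /= in A1 B1; rewrite E in B1.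
exact: ltW (dist_split A1 B1).
Qed.

Lemma derive0_ball_cst u x (r : R) :
  (forall y, ball x r y -> differentiable u y /\ forall v, 'D_v u y = 0) ->
  forall y, ball x r y -> u y = u x.
Proof.
move=> du y; rewrite -ball_normE /= => xy.
have inB s : s \in `[0, 1] -> ball x r (x + s *: (y - x)).
  rewrite in_itv /= => /andP[s0 s1].
  rewrite -ball_normE /= opprD addrA subrr add0r normrN normrZ ger0_norm // distrC.
  by rewrite (le_lt_trans _ xy) // ler_piMl.
have [||s sI] := @MVT_line u x (y - x) 1; first exact: ler01.
  by move=> s /inB /du[].
by rewrite (du _ (inB _ sI)).2 mulr0 scale1r [x + _]addrC subrK => /eqP; rewrite subr_eq0 => /eqP.
Qed.

End MeanValue.

Lemma smooth_schwarz (R : realType) (m : nat) (U : set 'rV[R]_m) (u : 'rV[R]_m -> R^o) x v w :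
  open U -> smooth_on U u -> U x -> 'D_v ('D_w u) x = 'D_w ('D_v u) x.
Proof.
move=> oU su Ux; apply: (@schwarz R 'rV[R]_m U u x v w oU Ux).
- by move=> y; exact: smooth_differentiable.
- by move=> z y; apply: smooth_differentiable; exact: smooth_derive.
- by move=> z z' y Uy; apply: (smooth_derive z (smooth_derive z' su) 0).
Qed.

Lemma smooth_schwarz_mx (R : realType) (m p q : nat) (U : set 'rV[R]_m)
    (F : 'rV[R]_m -> 'M[R]_(p, q)) x v w :
  open U -> smooth_on U F -> U x -> 'D_v ('D_w F) x = 'D_w ('D_v F) x.
Proof.
move=> oU sF Ux; apply/matrixP => i j.
have sFij := (smooth_mxP oU F).1 sF i j.
have D z y : U y -> 'D_z F y i j = 'D_z (fun y => F y i j : R^o) y.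
  by move=> Uy; rewrite derive_mxE //; exact: smooth_differentiable Uy.
have DD z z' : 'D_z ('D_z' F) x i j = 'D_z ('D_z' (fun y => F y i j : R^o)) x.
  rewrite (derive_mxE z i j (smooth_differentiable (smooth_derive z' sF) Ux)).
  exact: eq_open_derive oU Ux (D z').
exact: etrans (DD v w) (etrans (smooth_schwarz v w oU sFij Ux) (esym (DD w v))).
Qed.

(** * Bilinear forms *)

Section InnerAlgebra.
Context {R : realType} {n : nat}.
Implicit Types (B : 'M[R]_n) (u v w : 'rV[R]_n) (a : R).

Lemma innerDl B u v w : inner B (u + v) w = inner B u w + inner B v w.
Proof. by rewrite /inner !mulmxDl mxE. Qed.

Lemma innerDr B u v w : inner B w (u + v) = inner B w u + inner B w v.
Proof. by rewrite /inner linearD mulmxDr mxE. Qed.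

Lemma innerZl B a u w : inner B (a *: u) w = a * inner B u w.
Proof. by rewrite /inner -!scalemxAl mxE. Qed.

Lemma innerZr B a u w : inner B w (a *: u) = a * inner B w u.
Proof. by rewrite /inner linearZ /= -scalemxAr mxE. Qed.

Lemma innerNl B u w : inner B (- u) w = - inner B u w.
Proof. by rewrite -scaleN1r innerZl mulN1r. Qed.

Lemma innerNr B u w : inner B w (- u) = - inner B w u.
Proof. by rewrite -scaleN1r innerZr mulN1r. Qed.

Lemma innerBl B u v w : inner B (u - v) w = inner B u w - inner B v w.
Proof. by rewrite innerDl innerNl. Qed.

Lemma innerBr B u v w : inner B w (u - v) = inner B w u - inner B w v.
Proof. by rewrite innerDr innerNr. Qed.

Lemma inner0l B w : inner B 0 w = 0.
Proof. by rewrite -(scale0r w) innerZl mul0r. Qed.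

Lemma inner0r B w : inner B w 0 = 0.
Proof. by rewrite -(scale0r w) innerZr mul0r. Qed.

Lemma inner_suml B (I : Type) (r : seq I) (F : I -> 'rV[R]_n) w :
  inner B (\sum_(i <- r) F i) w = \sum_(i <- r) inner B (F i) w.
Proof. by elim/big_rec2: _ => [|i y x _ <-]; rewrite ?inner0l // innerDl. Qed.

Lemma inner_sumr B (I : Type) (r : seq I) (F : I -> 'rV[R]_n) w :
  inner B w (\sum_(i <- r) F i) = \sum_(i <- r) inner B w (F i).
Proof. by elim/big_rec2: _ => [|i y x _ <-]; rewrite ?inner0r // innerDr. Qed.

Lemma innerDm B C u v : inner (B + C) u v = inner B u v + inner C u v.
Proof. by rewrite /inner mulmxDr mulmxDl mxE. Qed.

Lemma innerZm B a u v : inner (a *: B) u v = a * inner B u v.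
Proof. by rewrite /inner -scalemxAr -scalemxAl mxE. Qed.

Lemma inner_basis B i j : inner B (basis_vec i) (basis_vec j) = B i j.
Proof. by rewrite /inner /basis_vec -rowE trmx_delta -colE !mxE. Qed.

Lemma basis_sum u : u = \sum_i u 0 i *: basis_vec i.
Proof. exact: row_sum_delta. Qed.

Lemma innerE B u v : inner B u v = \sum_i \sum_j u 0 i * v 0 j * B i j.
Proof.
rewrite {1}(basis_sum u) inner_suml; apply: eq_bigr => i _.
rewrite innerZl {1}(basis_sum v) inner_sumr big_distrr /=; apply: eq_bigr => j _.
by rewrite innerZr inner_basis mulrA.
Qed.

Lemma innerC B u v : B^T = B -> inner B u v = inner B v u.
Proof.
by move=> sB; rewrite /inner -!trace_mx11 -mxtrace_tr !trmx_mul trmxK sB mulmxA.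
Qed.

Lemma inner_eq0 B u : B \in unitmx -> (forall w, inner B u w = 0) -> u = 0.
Proof.
move=> uB u0; rewrite -[u](mulmxK uB); apply/rowP => j.
rewrite (_ : u *m B = 0) ?mul0mx //; apply/rowP => k.
by have := u0 (basis_vec k); rewrite /inner trmx_delta -colE !mxE.
Qed.

Lemma posdef_unitmx B : (forall v, v != 0 -> 0 < inner B v v) -> B \in unitmx.
Proof.
move=> pB; rewrite -row_free_unit -kermx_eq0; apply/eqP/row_matrixP => i; rewrite row0.
have [//|/pB] := eqVneq (row i (kermx B)) 0.
by rewrite /inner -row_mul mulmx_ker row0 mul0mx mxE ltxx.
Qed.

End InnerAlgebra.

Section InnerDerivative.
Context {R : realType} {V : normedModType R}.

Lemma differentiable_sumR n (F : 'I_n -> V -> R^o) x :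
  (forall i, differentiable (F i) x) -> differentiable (fun y => \sum_i F i y : R^o) x.
Proof.
move=> dF; rewrite (_ : (fun y => _) = \sum_i F i); first exact: differentiable_sum.
by apply/funext => y; rewrite fct_sumE.
Qed.

Lemma derive_sumR n (F : 'I_n -> V -> R^o) x v :
  (forall i, differentiable (F i) x) ->
  'D_v (fun y => \sum_i F i y : R^o) x = \sum_i 'D_v (F i) x.
Proof.
move=> dF; rewrite -derive_sum; last by move=> i; exact: diff_derivable.
by congr ('D_v _ x); apply/funext => y; rewrite fct_sumE.
Qed.

Context {n : nat} (B : V -> 'M[R]_n) (u w : V -> 'rV[R]_n) (x : V).
Hypotheses (dB : differentiable B x) (du : differentiable u x) (dw : differentiable w x).

Let inner_sumE : (fun y => inner (B y) (u y) (w y) : R^o) =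
  (fun y => \sum_i \sum_j u y 0 i * w y 0 j * B y i j : R^o).
Proof. by apply/funext => y; rewrite innerE. Qed.

Let dBij i j := (differentiable_mxP B x).1 dB i j.
Let dui i := (differentiable_mxP u x).1 du 0 i.
Let dwi i := (differentiable_mxP w x).1 dw 0 i.

Lemma derive_inner v :
  'D_v (fun y => inner (B y) (u y) (w y) : R^o) x =
  inner ('D_v B x) (u x) (w x) + inner (B x) ('D_v u x) (w x) + inner (B x) (u x) ('D_v w x).
Proof.
rewrite inner_sumE !innerE -!big_split derive_sumR /=; last first.
  by move=> i; apply: differentiable_sumR => j;
    exact: (differentiableMR (differentiableMR (dui i) (dwi j)) (dBij i j)).
apply: eq_bigr => i _; rewrite -!big_split derive_sumR /=; last first.
  by move=> j; exact: (differentiableMR (differentiableMR (dui i) (dwi j)) (dBij i j)).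
apply: eq_bigr => j _.
rewrite (deriveMR v (differentiableMR (dui i) (dwi j)) (dBij i j)) (deriveMR v (dui i) (dwi j)).
rewrite (derive_mxE v i j dB) (derive_mxE v 0 i du) (derive_mxE v 0 j dw).
ring.
Qed.

End InnerDerivative.

(** * The Levi-Civita connection *)

Section Christoffel.
Context {R : realType} {n : nat}.
Implicit Types (G : 'rV[R]_n -> 'M[R]_n) (x u v w : 'rV[R]_n) (a : R).

(** With the upper index fixed the symbols form the matrix of a bilinear form, so the lemmas on
    [inner] apply to each component of [christoffel_vec]. *)
Definition christoffel_mx G k x : 'M[R]_n := \matrix_(i, j) christoffel G x i j k.

Lemma christoffel_vecE G x u v :
  christoffel_vec G x u v = \row_k inner (christoffel_mx G k x) u v.
Proof.
apply/rowP => k; rewrite !mxE innerE; apply: eq_bigr => i _; apply: eq_bigr => j _.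
by rewrite mxE.
Qed.

Lemma christoffel_vecDl G x u v w :
  christoffel_vec G x (u + v) w = christoffel_vec G x u w + christoffel_vec G x v w.
Proof. by rewrite !christoffel_vecE; apply/rowP => k; rewrite !mxE innerDl. Qed.

Lemma christoffel_vecDr G x u v w :
  christoffel_vec G x w (u + v) = christoffel_vec G x w u + christoffel_vec G x w v.
Proof. by rewrite !christoffel_vecE; apply/rowP => k; rewrite !mxE innerDr. Qed.

Lemma christoffel_vecZl G x a u w :
  christoffel_vec G x (a *: u) w = a *: christoffel_vec G x u w.
Proof. by rewrite !christoffel_vecE; apply/rowP => k; rewrite !mxE innerZl. Qed.

Lemma christoffel_vecZr G x a u w :
  christoffel_vec G x w (a *: u) = a *: christoffel_vec G x w u.
Proof. by rewrite !christoffel_vecE; apply/rowP => k; rewrite !mxE innerZr. Qed.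

Lemma christoffel_vec0l G x w : christoffel_vec G x 0 w = 0.
Proof. by rewrite -[X in christoffel_vec G x X w](scale0r 0) christoffel_vecZl scale0r. Qed.

(** Derivative of the symbols in the direction [t], with [u] and [v] frozen: the first-order part of
    the curvature. *)
Definition dchristoffel_vec G x t u v : 'rV[R]_n :=
  \row_k inner ('D_t (christoffel_mx G k) x) u v.

End Christoffel.

Section Metric.
Context {R : realType} {n : nat} {W : set 'rV[R]_n} {G : 'rV[R]_n -> 'M[R]_n}.
Hypotheses (oW : open W) (sG : smooth_on W G)
  (symG : forall x, W x -> (G x)^T = G x) (unitG : forall x, W x -> G x \in unitmx).
Implicit Types (x u v w t : 'rV[R]_n) (a : R).

Lemma derive_metric_sym x v : W x -> ('D_v G x)^T = 'D_v G x.
Proof.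
move=> Wx; have dG := smooth_differentiable sG Wx; apply/matrixP => i j; rewrite mxE.
rewrite (derive_mxE v j i dG) (derive_mxE v i j dG).
by apply: eq_open_derive oW Wx _ => y Wy; rewrite -[in LHS]symG // mxE.
Qed.

Lemma christoffelE x i j k : W x ->
  christoffel G x i j k = 2^-1 * \sum_l invmx (G x) k l *
    ('D_(basis_vec i) G x j l + 'D_(basis_vec j) G x i l - 'D_(basis_vec l) G x i j).
Proof.
move=> Wx; have dG := smooth_differentiable sG Wx.
rewrite /christoffel; congr (_ * _); apply: eq_bigr => l _; congr (_ * (_ + _ - _));
  exact: esym (derive_mxE _ _ _ dG).
Qed.

Lemma smooth_christoffel_mx k : smooth_on W (christoffel_mx G k).
Proof.
apply/(smooth_mxP oW) => i j.
apply: (@smooth_eq _ _ _ oW _ (fun x => 2^-1 * \sum_l invmx (G x) k l *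
    ('D_(basis_vec i) G x j l + 'D_(basis_vec j) G x i l - 'D_(basis_vec l) G x i j) : R^o)).
  by move=> x Wx; rewrite mxE christoffelE.
have sD v (p q : 'I_n) := (smooth_mxP oW ('D_v G)).1 (smooth_derive v sG) p q.
apply: (smoothM oW); first exact: smooth_cst.
apply: (smooth_sum oW) => l; apply: (smoothM oW).
  exact: (smooth_mxP oW _).1 (smooth_invmx oW unitG sG) k l.
by apply: (smoothD oW); [exact: (smoothD oW)|exact: (smoothN oW)].
Qed.

Lemma derive_metric_basis x v : W x -> 'D_v G x = \sum_i v 0 i *: 'D_(basis_vec i) G x.
Proof. by move=> Wx; apply: derive_basis; exact: smooth_differentiable Wx. Qed.

(** Koszul's formula for fields with constant components, whose brackets vanish. *)
Lemma koszul x u v w : W x ->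
  inner (G x) (christoffel_vec G x u v) w =
  2^-1 * (inner ('D_u G x) v w + inner ('D_v G x) u w - inner ('D_w G x) u v).
Proof.
move=> Wx.
have [T [TD TE chE]] : exists T : 'rV[R]_n -> 'M[R]_n,
  [/\ forall t, 'D_t G x = T t, forall t, T t = \sum_l t 0 l *: T (basis_vec l) &
   forall i j k, christoffel G x i j k = 2^-1 * \sum_l invmx (G x) k l *
    (T (basis_vec i) j l + T (basis_vec j) i l - T (basis_vec l) i j)].
  exists (fun t => 'D_t G x); split=> [//|t|i j k]; [exact: derive_metric_basis|exact: christoffelE].
rewrite !TD.
have Tsum t p q : inner (T t) p q = \sum_l t 0 l * inner (T (basis_vec l)) p q.
  rewrite TE /inner mulmx_sumr mulmx_suml summxE.
  by apply: eq_bigr => l _; rewrite -scalemxAr -scalemxAl mxE.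
have TsumE t p l : inner (T t) p (basis_vec l) =
    \sum_i \sum_j t 0 i * p 0 j * T (basis_vec i) j l.
  rewrite Tsum; apply: eq_bigr => i _.
  rewrite {1}(basis_sum p) inner_suml big_distrr /=; apply: eq_bigr => j _.
  by rewrite innerZl inner_basis mulrA.
(* Twice the right-hand side as a linear form in [w], evaluated on the basis; raising its index
   gives twice [christoffel_vec G x u v]. *)
pose c l := inner (T u) v (basis_vec l) + inner (T v) u (basis_vec l)
              - inner (T (basis_vec l)) u v.
have cE l : c l = \sum_i \sum_j u 0 i * v 0 j *
    (T (basis_vec i) j l + T (basis_vec j) i l - T (basis_vec l) i j).
  rewrite /c !TsumE innerE [X in _ + X - _]exchange_big /= -big_split -sumrB /=.
  apply: eq_bigr => i _; rewrite -big_split -sumrB /=; apply: eq_bigr => j _; ring.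
have GE : christoffel_vec G x u v = 2^-1 *: ((\row_l c l) *m invmx (G x)).
  apply/rowP => k; rewrite !mxE.
  under eq_bigr => i _ do under eq_bigr => j _ do rewrite chE mulrCA big_distrr /=.
  under eq_bigr => i _ do rewrite -big_distrr /= exchange_big /=.
  rewrite -big_distrr /= exchange_big /=; congr (_ * _); apply: eq_bigr => l _.
  have -> : invmx (G x) l k = invmx (G x) k l by rewrite -[in LHS](symG Wx) -trmx_inv mxE.
  rewrite mxE cE mulrC big_distrr /=; apply: eq_bigr => i _.
  by rewrite big_distrr /=; apply: eq_bigr => j _; rewrite mulrCA.
rewrite GE innerZl; congr (_ * _).
rewrite /inner mulmxKV ?unitG // mxE.
transitivity (\sum_l w 0 l * c l); first by apply: eq_bigr => l _; rewrite !mxE mulrC.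
rewrite -!/(inner _ _ _) (Tsum w) [w in inner (T u) v w]basis_sum [w in inner (T v) u w]basis_sum.
rewrite !inner_sumr -big_split -sumrB /=.
by apply: eq_bigr => l _; rewrite !innerZr /c; ring.
Qed.

(* [T] abstracts the derivative, so that [ring] need not compare derivatives. *)
Lemma koszul_abstract x : W x -> exists T : 'rV[R]_n -> 'M[R]_n,
  [/\ forall t, 'D_t G x = T t, forall t u v, inner (T t) u v = inner (T t) v u &
   forall u v w, inner (G x) (christoffel_vec G x u v) w =
     2^-1 * (inner (T u) v w + inner (T v) u w - inner (T w) u v)].
Proof.
move=> Wx; exists (fun t => 'D_t G x); split=> [//|t u v|u v w]; last exact: koszul.
by rewrite innerC // derive_metric_sym.
Qed.

Lemma christoffel_vecC x u v : W x -> christoffel_vec G x u v = christoffel_vec G x v u.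
Proof.
move=> Wx; have [T [_ TC TE]] := koszul_abstract Wx.
apply/eqP; rewrite -subr_eq0; apply/eqP.
apply: (inner_eq0 (unitG Wx)) => w; rewrite innerBl !TE (TC w v u); ring.
Qed.

(** In the sum of the two Koszul formulas the derivatives of the metric along [u] and [v] cancel in
    pairs, and the two halves of the derivative along [t] add up. *)
Lemma metric_compat x t u v : W x ->
  inner ('D_t G x) u v =
  inner (G x) (christoffel_vec G x t u) v + inner (G x) u (christoffel_vec G x t v).
Proof.
move=> Wx; have [T [-> TC TE]] := koszul_abstract Wx.
rewrite [inner (G x) u _]innerC ?symG // !TE (TC t v u).
by field.
Qed.

End Metric.

(** * Connection along a map and curvature *)

Section ConnectionAlong.
Context {R : realType} {m n : nat} {O : set 'rV[R]_m} {W : set 'rV[R]_n}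
  {G : 'rV[R]_n -> 'M[R]_n} {F : 'rV[R]_m -> 'rV[R]_n}.
Hypotheses (oW : open W) (sG : smooth_on W G)
  (symG : forall x, W x -> (G x)^T = G x) (unitG : forall x, W x -> G x \in unitmx).
Hypotheses (oO : open O) (sF : smooth_on O F) (FO : forall x, O x -> W (F x)).
Implicit Types (x X Y Z : 'rV[R]_m) (U V : 'rV[R]_m -> 'rV[R]_n).

Lemma nablaE X U x : nabla_along G F (cst X) U x =
  'D_X U x + christoffel_vec G (F x) ('D_X F x) (U x).
Proof. by []. Qed.

Lemma nabla_linear U x a X Y : O x -> differentiable U x ->
  nabla_along G F (cst (a *: X + Y)) U x =
  a *: nabla_along G F (cst X) U x + nabla_along G F (cst Y) U x.
Proof.
move=> Ox dU; rewrite !nablaE (derive_linear X Y a dU).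
rewrite (derive_linear X Y a (smooth_differentiable sF Ox)).
by rewrite christoffel_vecDl christoffel_vecZl scalerDr; exact: addrACA.
Qed.

Lemma nabla_eq U V X x : O x -> (forall y, O y -> U y = V y) ->
  nabla_along G F (cst X) U x = nabla_along G F (cst X) V x.
Proof. by move=> Ox UV; rewrite !nablaE (UV x Ox) (eq_open_derive X oO Ox UV). Qed.

Lemma nablaD U V X x : differentiable U x -> differentiable V x ->
  nabla_along G F (cst X) (fun y => U y + V y) x =
  nabla_along G F (cst X) U x + nabla_along G F (cst X) V x.
Proof.
move=> dU dV; rewrite !nablaE christoffel_vecDr [RHS]addrACA; congr (_ + _).
by rewrite [LHS](@deriveD _ _ _ U V) //; exact: diff_derivable.
Qed.

Lemma nablaZ (a : 'rV[R]_m -> R^o) U X x : differentiable a x -> differentiable U x ->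
  nabla_along G F (cst X) (fun y => a y *: U y) x =
  'D_X a x *: U x + a x *: nabla_along G F (cst X) U x.
Proof.
move=> da dU; rewrite !nablaE christoffel_vecZr scalerDr addrA; congr (_ + _).
have dUi i := (differentiable_mxP U x).1 dU 0 i.
have daU : differentiable (fun y => a y *: U y) x.
  apply/differentiable_mxP => i j; rewrite (ord1 i).
  rewrite (_ : (fun y => _) = (fun y => a y * U y 0 j : R^o)); last first.
    by apply/funext => y; rewrite mxE.
  exact: differentiableMR da (dUi j).
apply/rowP => j; rewrite (derive_mxE X 0 j daU).
rewrite (_ : (fun y => _) = (fun y => a y * U y 0 j : R^o)); last first.
  by apply/funext => y; rewrite mxE.
by rewrite (deriveMR X da (dUi j)) !mxE (derive_mxE X 0 j dU) [_ * 'D_X a x]mulrC addrC.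
Qed.

Lemma differentiable_metric_along x : O x -> differentiable (G \o F) x.
Proof.
move=> Ox; apply: differentiable_comp; first exact: (smooth_differentiable sF Ox).
exact: smooth_differentiable sG (FO Ox).
Qed.

Lemma derive_inner_along U V X x : O x -> differentiable U x -> differentiable V x ->
  'D_X (fun y => inner (G (F y)) (U y) (V y) : R^o) x =
  inner (G (F x)) (nabla_along G F (cst X) U x) (V x) +
  inner (G (F x)) (U x) (nabla_along G F (cst X) V x).
Proof.
move=> Ox dU dV; have dF := smooth_differentiable sF Ox; have dG := smooth_differentiable sG (FO Ox).
rewrite (derive_inner (differentiable_metric_along Ox) dU dV X) (derive_comp X dF dG).
rewrite (metric_compat oW sG symG unitG _ _ _ (FO Ox)) !nablaE innerDl innerDr.
by rewrite /= -!addrA [RHS]addrCA; congr (_ + _); rewrite addrC -addrA.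
Qed.

Lemma smooth_comp_mx (p q : nat) (B : 'rV[R]_n -> 'M[R]_(p, q)) :
  smooth_on W B -> smooth_on O (B \o F).
Proof.
move=> sB; apply/(smooth_mxP oO) => i j.
exact: (smooth_comp oO FO sF ((smooth_mxP oW B).1 sB i j)).
Qed.

Lemma smooth_christoffel_along U V : smooth_on O U -> smooth_on O V ->
  smooth_on O (fun y => christoffel_vec G (F y) (U y) (V y)).
Proof.
move=> sU sV; apply/(smooth_mxP oO) => i k.
apply: (@smooth_eq _ _ _ oO _ (fun y => inner (christoffel_mx G k (F y)) (U y) (V y) : R^o)).
  by move=> y _; rewrite christoffel_vecE mxE.
apply: (smooth_inner oO) => //; apply: smooth_comp_mx; exact: smooth_christoffel_mx.
Qed.

Lemma smooth_nabla X U : smooth_on O U -> smooth_on O (nabla_along G F (cst X) U).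
Proof.
move=> sU; apply: (smoothD oO); first exact: smooth_derive.
by apply: smooth_christoffel_along => //; exact: smooth_derive.
Qed.

Lemma derive_christoffel_along U V X x : O x -> smooth_on O U -> smooth_on O V ->
  'D_X (fun y => christoffel_vec G (F y) (U y) (V y)) x =
  dchristoffel_vec G (F x) ('D_X F x) (U x) (V x) +
  christoffel_vec G (F x) ('D_X U x) (V x) + christoffel_vec G (F x) (U x) ('D_X V x).
Proof.
move=> Ox sU sV; apply/rowP => k.
have dU := smooth_differentiable sU Ox; have dV := smooth_differentiable sV Ox.
have dF := smooth_differentiable sF Ox.
have sC := smooth_christoffel_mx oW sG unitG k.
have dC := smooth_differentiable sC (FO Ox).
have dCF := smooth_differentiable (smooth_comp_mx sC) Ox.
rewrite (derive_mxE X 0 k (smooth_differentiable (smooth_christoffel_along sU sV) Ox)).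
rewrite (_ : (fun y => _) = (fun y => inner ((christoffel_mx G k \o F) y) (U y) (V y) : R^o)).
  rewrite (derive_inner dCF dU dV X) (derive_comp X dF dC).
  by rewrite !christoffel_vecE !mxE.
by apply/funext => y; rewrite christoffel_vecE mxE.
Qed.

(** The expansion is sorted for antisymmetrization in [X] and [Y]: the second derivatives of [U] and
    [F] are symmetric and the two mixed terms are exchanged, so only the terms of the curvature
    survive. *)
Lemma nabla2E U X Y x : O x -> smooth_on O U ->
  nabla_along G F (cst X) (nabla_along G F (cst Y) U) x =
  'D_X ('D_Y U) x + dchristoffel_vec G (F x) ('D_X F x) ('D_Y F x) (U x)
  + christoffel_vec G (F x) ('D_X ('D_Y F) x) (U x)
  + christoffel_vec G (F x) ('D_Y F x) ('D_X U x)
  + christoffel_vec G (F x) ('D_X F x) ('D_Y U x)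
  + christoffel_vec G (F x) ('D_X F x) (christoffel_vec G (F x) ('D_Y F x) (U x)).
Proof.
move=> Ox sU.
have sDF := smooth_derive Y sF; have sDU := smooth_derive Y sU.
have sC := smooth_christoffel_along sDF sU.
have NE : nabla_along G F (cst X) (nabla_along G F (cst Y) U) x =
  'D_X (fun y => 'D_Y U y + christoffel_vec G (F y) ('D_Y F y) (U y)) x
  + christoffel_vec G (F x) ('D_X F x) ('D_Y U x + christoffel_vec G (F x) ('D_Y F x) (U x)) by [].
have DE : 'D_X (fun y => 'D_Y U y + christoffel_vec G (F y) ('D_Y F y) (U y)) x =
   'D_X ('D_Y U) x + 'D_X (fun y => christoffel_vec G (F y) ('D_Y F y) (U y)) x.
  apply: (@deriveD _ _ _ ('D_Y U) (fun y => christoffel_vec G (F y) ('D_Y F y) (U y)));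
  by apply: diff_derivable; exact: smooth_differentiable Ox.
apply: etrans NE _; apply: etrans (congr2 +%R DE (christoffel_vecDr _ _ _ _ _)) _.
apply: etrans (congr2 +%R (congr2 +%R (erefl _) (derive_christoffel_along X Ox sDF sU)) (erefl _)) _.
by rewrite !addrA.
Qed.

End ConnectionAlong.

(** * Symmetries of the curvature tensor *)

Section Curvature.
Context {R : realType} {n : nat} {W : set 'rV[R]_n} {G : 'rV[R]_n -> 'M[R]_n}.
Hypotheses (oW : open W) (sG : smooth_on W G)
  (symG : forall x, W x -> (G x)^T = G x) (unitG : forall x, W x -> G x \in unitmx).
Implicit Types (x u v w t : 'rV[R]_n).

(** [levi_civita] is the connection along [id], so the results on connections along a map specialize
    to it. *)
Lemma smooth_id : smooth_on W (@id 'rV[R]_n).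
Proof.
have sc k a : Ck k W (fun=> a : 'rV[R]_n) := @Ck_cst R n 'rV[R]_n k W a.
case=> [|k] /=; first by move=> x _; exact: cvg_id.
split=> [x _|v]; first exact: ex_diff.
rewrite (_ : 'D_v id = fun=> v) //; apply/funext => y; exact: derive_id.
Qed.

Let idW x (Wx : W x) : W (id x) := Wx.

(** The classical coordinate formula: the extensions have constant components, hence the bracket and
    all derivatives of the fields vanish. *)
Lemma riemannE x u v w : W x -> riemann G x u v w =
  dchristoffel_vec G x u v w - dchristoffel_vec G x v u w
  + (christoffel_vec G x u (christoffel_vec G x v w)
     - christoffel_vec G x v (christoffel_vec G x u w)).
Proof.
move=> Wx; rewrite /riemann /curvature.
have E a b : levi_civita G (cst a) (levi_civita G (cst b) (cst w)) x =
    dchristoffel_vec G x a b w + christoffel_vec G x a (christoffel_vec G x b w).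
  apply: etrans (nabla2E oW sG unitG oW smooth_id idW a b Wx (@smooth_cst R n W _ w)) _.
  have Dcst c (z y : 'rV[R]_n) : 'D_c (fun=> z : 'rV[R]_n) (y : 'rV[R]_n) = 0 by exact: derive_cst.
  have Did c (y : 'rV[R]_n) : 'D_c (@id 'rV[R]_n) y = c by exact: derive_id.
  have -> : 'D_b (@id 'rV[R]_n) = fun=> b by apply/funext => y; exact: Did.
  have -> : 'D_b (cst w : 'rV[R]_n -> 'rV[R]_n) = fun=> 0 by apply/funext => y; exact: Dcst.
  have C0 z : christoffel_vec G x z 0 = 0.
    by rewrite -[X in christoffel_vec G x z X](scale0r z) christoffel_vecZr scale0r.
  rewrite (Dcst a 0) (Dcst a b) (Dcst a w) Did.
  by rewrite (Did b) (Dcst b w) christoffel_vec0l !C0 !addr0 add0r.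
rewrite !E.
have -> : levi_civita G (lie_bracket (cst u) (cst v)) (cst w) x = 0.
  have L0 : lie_bracket (cst u) (cst v) x = 0.
    by rewrite /lie_bracket /= !derive_cst subrr.
  by rewrite /levi_civita /nabla_along L0 !derive0 christoffel_vec0l addr0.
by rewrite subr0 opprD addrACA.
Qed.

(* [d] and [c] abstract the Christoffel symbols for the same reason as [T] in
   [koszul_abstract]. *)
Lemma riemann_abstract x : W x ->
  exists (d : 'rV[R]_n -> 'rV[R]_n -> 'rV[R]_n -> 'rV[R]_n) (c : 'rV[R]_n -> 'rV[R]_n -> 'rV[R]_n),
  [/\ forall u v w, riemann G x u v w = d u v w - d v u w + (c u (c v w) - c v (c u w)),
      forall t u v, d t u v = d t v u, forall u v, c u v = c v u,
      (forall a t t' u v, d (a *: t + t') u v = a *: d t u v + d t' u v) /\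
      (forall a t u u' v, d t (a *: u + u') v = a *: d t u v + d t u' v) &
      forall a u u' v, c (a *: u + u') v = a *: c u v + c u' v].
Proof.
move=> Wx.
have [B [dE BL BS]] : exists B : 'I_n -> 'rV[R]_n -> 'M[R]_n,
    [/\ forall t u v, dchristoffel_vec G x t u v = \row_k inner (B k t) u v,
        forall k a t t', B k (a *: t + t') = a *: B k t + B k t' &
        forall k t, (B k t)^T = B k t].
  exists (fun k t => 'D_t (christoffel_mx G k) x); split=> // k.
    move=> a t t'; apply: derive_linear.
    exact: smooth_differentiable (smooth_christoffel_mx oW sG unitG k) Wx.
  move=> t; apply: (derive_metric_sym oW (smooth_christoffel_mx oW sG unitG k)) => // y Wy.
  apply/matrixP => i j; rewrite !mxE.
  have := congr1 (fun z : 'rV[R]_n => z 0 k) (christoffel_vecC oW sG symG unitG (basis_vec j) (basis_vec i) Wy).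
  by rewrite !christoffel_vecE !mxE !inner_basis !mxE.
exists (fun t u v => \row_k inner (B k t) u v), (christoffel_vec G x); split.
- by move=> u v w; rewrite -!dE; exact: riemannE.
- by move=> t u v; apply/rowP => k; rewrite !mxE innerC.
- by move=> u v; exact: (christoffel_vecC oW sG symG unitG).
- split=> [a t t' u v|a t u u' v]; apply/rowP => k; last by rewrite !mxE innerDl innerZl.
  by rewrite !mxE BL innerDm innerZm.
- by move=> a u u' v; rewrite christoffel_vecDl christoffel_vecZl.
Qed.

Lemma riemannC x u v w : W x -> riemann G x u v w = - riemann G x v u w.
Proof. by move=> Wx; have [d [c [E _ _ _ _]]] := riemann_abstract Wx; rewrite !E opprD !opprB. Qed.

Lemma bianchi x u v w : W x ->
  riemann G x u v w + riemann G x v w u + riemann G x w u v = 0.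
Proof.
move=> Wx; have [d [c [E dC cC _ _]]] := riemann_abstract Wx; rewrite !E.
rewrite (cC w v) (cC u w) (cC v u) (dC v w u) (dC w v u) (dC u w v).
by apply/rowP => k; rewrite !mxE; ring.
Qed.

Lemma riemann_linear_l x a u u' v w : W x ->
  riemann G x (a *: u + u') v w = a *: riemann G x u v w + riemann G x u' v w.
Proof.
move=> Wx; have [d [c [E _ cC [dL1 dL2] cL]]] := riemann_abstract Wx.
have cR b z z' y : c y (b *: z + z') = b *: c y z + c y z' by rewrite ![c y _]cC cL.
rewrite !E dL1 dL2 !cL !cR.
by apply/rowP => k; rewrite !mxE; ring.
Qed.

Lemma riemann_linear_m x a u v v' w : W x ->
  riemann G x u (a *: v + v') w = a *: riemann G x u v w + riemann G x u v' w.
Proof.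
move=> Wx; rewrite riemannC // riemann_linear_l // [riemann G x u v w]riemannC //.
by rewrite [riemann G x u v' w]riemannC // opprD scalerN.
Qed.

Lemma riemann_linear_r x a u v w w' : W x ->
  riemann G x u v (a *: w + w') = a *: riemann G x u v w + riemann G x u v w'.
Proof.
move=> Wx; have [d [c [E dC cC [_ dL2] cL]]] := riemann_abstract Wx.
have cR b z z' y : c y (b *: z + z') = b *: c y z + c y z' by rewrite ![c y _]cC cL.
have dR b z z' t y : d t y (b *: z + z') = b *: d t y z + d t y z' by rewrite ![d t y _]dC dL2.
rewrite !E !dR !cR.
by apply/rowP => k; rewrite !mxE; ring.
Qed.

Lemma second_derivative_commutator (a d1 d2 p q r c1 c2 : 'rV[R]_n) :
  (a + d1 + p + q + r + c1) - (a + d2 + p + r + q + c2) = d1 - d2 + (c1 - c2).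
Proof. by apply/rowP => k; rewrite !mxE; ring. Qed.

(** The curvature of a pull-back connection is the pull-back of the curvature. There is no bracket
    term, since [X] and [Y] are constant fields of the source. *)
Lemma nabla_curvature (m : nat) (O : set 'rV[R]_m) (F U : 'rV[R]_m -> 'rV[R]_n) (X Y x : 'rV[R]_m) :
  open O -> smooth_on O F -> (forall y, O y -> W (F y)) -> smooth_on O U -> O x ->
  nabla_along G F (cst X) (nabla_along G F (cst Y) U) x
  - nabla_along G F (cst Y) (nabla_along G F (cst X) U) x
  = riemann G (F x) ('D_X F x) ('D_Y F x) (U x).
Proof.
move=> oO sF FO sU Ox.
have N2 := nabla2E oW sG unitG oO sF FO _ _ Ox sU.
(* The symmetry of second derivatives brings both expansions to the same mixed derivatives of [U]
   and [F], which then cancel. *)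
have {}N2Y : nabla_along G F (cst Y) (nabla_along G F (cst X) U) x =
  'D_X ('D_Y U) x + dchristoffel_vec G (F x) ('D_Y F x) ('D_X F x) (U x)
  + christoffel_vec G (F x) ('D_X ('D_Y F) x) (U x)
  + christoffel_vec G (F x) ('D_X F x) ('D_Y U x)
  + christoffel_vec G (F x) ('D_Y F x) ('D_X U x)
  + christoffel_vec G (F x) ('D_Y F x) (christoffel_vec G (F x) ('D_X F x) (U x)).
  have EF := smooth_schwarz_mx X Y oO sF Ox; have EU := smooth_schwarz_mx X Y oO sU Ox.
  have C := congr2 (fun p q => p
    + dchristoffel_vec G (F x) ('D_Y F x) ('D_X F x) (U x)
    + christoffel_vec G (F x) q (U x)
    + christoffel_vec G (F x) ('D_X F x) ('D_Y U x)
    + christoffel_vec G (F x) ('D_Y F x) ('D_X U x)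
    + christoffel_vec G (F x) ('D_Y F x) (christoffel_vec G (F x) ('D_X F x) (U x)))
    (esym EU) (esym EF).
  exact (etrans (N2 Y X) C).
have C := congr2 (fun a b : 'rV[R]_n => a - b) (N2 X Y) N2Y.
exact (etrans C (etrans (second_derivative_commutator _ _ _ _ _ _ _ _) (esym (riemannE _ _ _ (FO x Ox))))).
Qed.

Lemma skew_of_commutator (a1 a2 a3 a4 p q : R) :
  a1 + p + (q + a3) = a2 + q + (p + a4) -> a1 - a2 = - (a3 - a4).
Proof. by move=> E; lra. Qed.

(** The second derivatives of the product of the constant fields [w] and [t] commute. Expanded by
    metric compatibility, their products of first covariant derivatives are symmetric in [u] and
    [v], and only the two curvature terms remain. *)
Lemma riemann_skew x u v w t : W x ->
  inner (G x) (riemann G x u v w) t = - inner (G x) (riemann G x u v t) w.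
Proof.
move=> Wx.
have sc (a : 'rV[R]_n) : smooth_on W (cst a) := @smooth_cst R n W _ a.
have DI := derive_inner_along oW sG symG unitG smooth_id idW.
have sN a b := smooth_nabla oW sG unitG oW smooth_id idW a (sc b).
pose N a b := nabla_along G id (cst a) (cst b).
have D1 a y : W y -> 'D_a (fun y => inner (G y) w t : R^o) y =
    inner (G y) (N a w y) t + inner (G y) w (N a t y).
  by move=> Wy; apply: (DI (cst w) (cst t) a y Wy); exact: (smooth_differentiable (sc _) Wy).
have D2 a b : 'D_a ('D_b (fun y => inner (G y) w t : R^o)) x =
    inner (G x) (nabla_along G id (cst a) (N b w) x) t + inner (G x) (N b w x) (N a t x) +
    (inner (G x) (N a w x) (N b t x) + inner (G x) w (nabla_along G id (cst a) (N b t) x)).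
  apply: etrans (eq_open_derive a oW Wx (D1 b)) _.
  have d1 : smooth_on W (fun y => inner (G y) (N b w y) t : R^o).
    exact: (smooth_inner oW sG (sN b w) (sc t)).
  have d2 : smooth_on W (fun y => inner (G y) w (N b t y) : R^o).
    exact: (smooth_inner oW sG (sc w) (sN b t)).
  apply: etrans (deriveD (diff_derivable (v := a) (smooth_differentiable d1 Wx))
                     (diff_derivable (v := a) (smooth_differentiable d2 Wx))) _.
  have dN c z := smooth_differentiable (sN c z) Wx.
  have dc z := smooth_differentiable (sc z) Wx.
  congr (_ + _); first exact: (DI (N b w) (cst t) a x Wx (dN b w) (dc t)).
  exact: (DI (cst w) (N b t) a x Wx (dc w) (dN b t)).
have sq : smooth_on W (fun y => inner (G y) w t : R^o) := smooth_inner oW sG (sc w) (sc t).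
have S := smooth_schwarz u v oW sq Wx.
have RE z : riemann G x u v z = nabla_along G id (cst u) (N v z) x - nabla_along G id (cst v) (N u z) x.
  have E := nabla_curvature u v oW smooth_id idW (sc z) Wx.
  by rewrite !derive_id in E; rewrite E.
have {}S := skew_of_commutator (etrans (esym (D2 u v)) (etrans S (D2 v u))).
rewrite (RE w) (RE t) [inner _ (_ - _) w]innerC ?symG // innerBl innerBr.
exact: S.
Qed.

(** The usual combination of four Bianchi identities, one for each choice of the last argument; the
    skew symmetries identify the remaining terms in pairs. *)
Lemma pair_symmetry (T : Type) (r : T -> T -> T -> T -> R) (u v w t : T) :
  (forall a b c d, r a b c d = - r b a c d) -> (forall a b c d, r a b c d = - r a b d c) ->
  (forall a b c d, r a b c d + r b c a d + r c a b d = 0) ->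
  r u v w t = r w t u v.
Proof.
move=> C1 C2 B.
have := B u v w t; have := B v w t u; have := B w t u v; have := B t u v w.
rewrite (C2 v w t u) (C2 w t v u) (C2 t u v w) (C2 u v t w).
rewrite (C1 u w t v) (C2 w u t v) (C1 v t u w) (C2 t v u w).
lra.
Qed.

Lemma riemann_pair x u v w t : W x ->
  inner (G x) (riemann G x u v w) t = inner (G x) (riemann G x w t u) v.
Proof.
move=> Wx; apply: (@pair_symmetry _ (fun a b c d => inner (G x) (riemann G x a b c) d)).
- by move=> a b c d; rewrite riemannC // innerNl.
- by move=> a b c d; rewrite riemann_skew.
- by move=> a b c d; rewrite -!innerDl bianchi // inner0l.
Qed.

End Curvature.

(** * Traces and adapted frames *)

Section MetricTrace.
Context {R : realType} {m : nat} (B : 'M[R]_m).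
Hypotheses (symB : B^T = B) (unitB : B \in unitmx).
Implicit Types (X Y Z w : 'rV[R]_m).

Lemma invmx_sym i j : invmx B i j = invmx B j i.
Proof. by rewrite -[in LHS]symB -trmx_inv mxE. Qed.

Lemma inv_inner_basis i w : \sum_j invmx B i j * inner B (basis_vec j) w = w 0 i.
Proof.
have -> : \sum_j invmx B i j * inner B (basis_vec j) w = (invmx B *m (B *m w^T)) i 0.
  rewrite mxE; apply: eq_bigr => j _; congr (_ * _).
  by rewrite /inner -mulmxA -rowE mxE.
by rewrite mulKmx // mxE.
Qed.

(** The inverse metric raises the index lowered by [inner], so tracing against the form dual to [w]
    evaluates the linear map given by [T] at [w]. *)
Lemma trace_dual (V : lmodType R) (T : 'I_m -> V) w :
  \sum_i \sum_j invmx B i j *: (inner B (basis_vec j) w *: T i) = \sum_i w 0 i *: T i.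
Proof.
apply: eq_bigr => i _; rewrite -(inv_inner_basis i w) scaler_suml.
by apply: eq_bigr => j _; rewrite scalerA.
Qed.

Lemma trace_dualC (V : lmodType R) (T : 'I_m -> V) w :
  \sum_i \sum_j invmx B i j *: (inner B (basis_vec i) w *: T j) = \sum_i w 0 i *: T i.
Proof.
rewrite exchange_big /= -(trace_dual T); apply: eq_bigr => i _; apply: eq_bigr => j _.
by rewrite invmx_sym.
Qed.

(** The dimension enters the later computations through this trace. *)
Lemma trace_inner : \sum_i \sum_j invmx B i j * inner B (basis_vec i) (basis_vec j) = m%:R.
Proof.
rewrite -(mxtrace1 R m) -(mulVmx unitB) /mxtrace; apply: eq_bigr => i _; rewrite mxE.
by apply: eq_bigr => j _; rewrite inner_basis; congr (_ * _); rewrite -[in LHS]symB mxE.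
Qed.

End MetricTrace.

Section TraceMetric.
Context {R : realType} {m n : nat} (B : 'M[R]_m).
Implicit Types (S T : 'I_m -> 'I_m -> 'rV[R]_n).

Lemma inner_trace_metric (K : 'M[R]_n) T w :
  inner K (trace_metric B T) w = \sum_i \sum_j invmx B i j * inner K (T i j) w.
Proof.
rewrite /trace_metric inner_suml; apply: eq_bigr => i _.
by rewrite inner_suml; apply: eq_bigr => j _; rewrite innerZl.
Qed.

Lemma trace_metricD S T :
  trace_metric B (fun i j => S i j + T i j) = trace_metric B S + trace_metric B T.
Proof.
rewrite /trace_metric -big_split; apply: eq_bigr => i _ /=.
by rewrite -big_split; apply: eq_bigr => j _ /=; rewrite scalerDr.
Qed.

Lemma trace_metricN T : trace_metric B (fun i j => - T i j) = - trace_metric B T.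
Proof.
rewrite /trace_metric -sumrN; apply: eq_bigr => i _.
by rewrite -sumrN; apply: eq_bigr => j _; rewrite scalerN.
Qed.

Lemma eq_trace_metric S T : (forall i j, S i j = T i j) -> trace_metric B S = trace_metric B T.
Proof. by move=> ST; apply: eq_bigr => i _; apply: eq_bigr => j _; rewrite ST. Qed.

Lemma trace_metricZ (a : R) T : a != 0 -> B \in unitmx ->
  trace_metric (a^-1 *: B) T = a *: trace_metric B T.
Proof.
move=> a0 uB; rewrite /trace_metric scaler_sumr; apply: eq_bigr => i _.
rewrite scaler_sumr; apply: eq_bigr => j _.
by rewrite invmxZ ?unitmxZ ?unitfE ?invr_eq0 // mxE invrK scalerA.
Qed.

Lemma trace_metric_linear (p : nat) (f : 'rV[R]_n -> 'rV[R]_p) T :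
  (forall a u v, f (a *: u + v) = a *: f u + f v) ->
  trace_metric B (fun i j => f (T i j)) = f (trace_metric B T).
Proof.
move=> fL.
have f0 : f 0 = 0 by have := fL (-1) 0 0; rewrite scaler0 addr0 scaleN1r addNr.
have fD u v : f (u + v) = f u + f v by rewrite -{1}(scale1r u) fL scale1r.
have fZ a u : f (a *: u) = a *: f u by rewrite -[a *: u]addr0 fL f0 addr0.
have fs := big_morph f fD f0.
rewrite /trace_metric fs; apply: eq_bigr => i _; rewrite fs; apply: eq_bigr => j _.
by rewrite fZ.
Qed.

End TraceMetric.

(** * Frames made of a tangent plane and its unit normal *)

Section AdaptedFrame.
Context {R : realType} (B : 'M[R]_3) (J : 'M[R]_(2, 3)) (xi : 'rV[R]_3).
Hypotheses (symB : B^T = B) (unitg : J *m B *m J^T \in unitmx)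
  (xi1 : inner B xi xi = 1) (xiJ : forall X, inner B xi (X *m J) = 0).

Let JBxi : J *m B *m xi^T = 0.
Proof.
apply/colP => i; rewrite [RHS]mxE -(xiJ (basis_vec i)) innerC //.
by rewrite /inner -!mulmxA -rowE [RHS]mxE mulmxA.
Qed.

Let xiBJ : xi *m B *m J^T = 0.
Proof. apply: trmx_inj; rewrite !trmx_mul trmxK symB trmx0 mulmxA; exact: JBxi. Qed.

Let xiBxi : xi *m B *m xi^T = 1%:M.
Proof. by rewrite [LHS]mx11_scalar; congr (_%:M). Qed.

(** Resolution of the identity: the inverse of the ambient metric is the sum of the inverse induced
    metric, carried to the ambient space by [J], and the square of the normal. *)
Lemma frame_completeness :
  B *m (J^T *m invmx (J *m B *m J^T) *m J + xi^T *m xi) = 1%:M.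
Proof.
set K := _ + _.
(* The Gram matrix of the frame is block diagonal with invertible blocks, so [P] is invertible and
   may be cancelled from [P *m (B *m K) = P]. *)
pose P : 'M[R]_(2 + 1, 3) := col_mx J xi.
have PBP : P *m B *m P^T = block_mx (J *m B *m J^T) 0 0 1%:M.
  by rewrite tr_col_mx mul_col_mx mul_col_row JBxi xiBJ xiBxi.
have PU : (P : 'M[R]_3) \in unitmx.
  have : P *m (B *m P^T) \in unitmx.
    by rewrite mulmxA PBP unitmxE det_ublock det1 mulr1 -unitmxE.
  by rewrite unitmx_mul => /andP[].
have PBK : P *m (B *m K) = P.
  rewrite mulmxA mul_col_mx mul_col_mx /K !mulmxDr !mulmxA.
  by rewrite mulmxV // mul1mx JBxi mul0mx addr0 xiBJ !mul0mx add0r xiBxi mul1mx.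
by rewrite -(mulKmx PU (B *m K)) (PBK : (P : 'M[R]_3) *m (B *m K) = (P : 'M[R]_3)) mulVmx.
Qed.

(** The resolution of the identity is inserted after [L]; cyclicity of the trace then splits it into
    its tangential and normal parts. *)
Lemma frame_trace (L : 'M[R]_3) :
  \tr L = \sum_i \sum_j invmx (J *m B *m J^T) i j *
            inner B (basis_vec i *m J *m L) (basis_vec j *m J)
          + inner B (xi *m L) xi.
Proof.
have symg : (J *m B *m J^T)^T = J *m B *m J^T by rewrite !trmx_mul trmxK symB mulmxA.
rewrite -[L in LHS]mulmx1 -frame_completeness mulmxA mulmxDr mxtraceD; congr (_ + _).
  rewrite !mulmxA mxtrace_mulC !mulmxA mxtrace_mulC /mxtrace.
  under eq_bigr => i _ do rewrite mxE.
  rewrite exchange_big; apply: eq_bigr => i _; apply: eq_bigr => j _ /=.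
  rewrite (invmx_sym symg); congr (_ * _).
  by rewrite -[LHS]inner_basis /inner trmx_mul !mulmxA.
by rewrite mulmxA mxtrace_mulC /inner -[RHS]trace_mx11 !mulmxA.
Qed.

Lemma frame_eq0 w : (forall X, inner B w (X *m J) = 0) -> inner B w xi = 0 -> w = 0.
Proof.
move=> wJ wxi; rewrite -[w]mulmx1 -frame_completeness mulmxA mulmxDr.
have wBxi : w *m B *m xi^T = 0 by rewrite [LHS]mx11_scalar -/(inner B w xi) wxi -scalemx1 scale0r.
have wBJ : w *m B *m J^T = 0.
  apply/rowP => i; rewrite [in RHS]mxE; have := wJ (basis_vec i).
  by rewrite /inner trmx_mul trmx_delta mulmxA -colE mxE.
by rewrite !mulmxA wBJ wBxi !mul0mx addr0.
Qed.

End AdaptedFrame.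

(** * Ricci curvature along a surface *)

Section Ricci.
Context {R : realType} {n : nat} {W : set 'rV[R]_n} {G : 'rV[R]_n -> 'M[R]_n}.
Hypotheses (oW : open W) (sG : smooth_on W G)
  (symG : forall x, W x -> (G x)^T = G x) (unitG : forall x, W x -> G x \in unitmx).
Implicit Types (x u v w z : 'rV[R]_n).

Lemma riemann0l x z w : W x -> riemann G x 0 z w = 0.
Proof.
move=> Wx; have := riemann_linear_l oW sG symG unitG (-1) 0 0 z w Wx.
by rewrite scaler0 addr0 scaleN1r addNr.
Qed.

Lemma riemann_suml x z w (I : Type) (r : seq I) (a : I -> R) (u : I -> 'rV[R]_n) : W x ->
  riemann G x (\sum_(i <- r) a i *: u i) z w = \sum_(i <- r) a i *: riemann G x (u i) z w.
Proof.
move=> Wx; elim: r => [|i r IH]; first by rewrite !big_nil riemann0l.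
by rewrite !big_cons (riemann_linear_l oW sG symG unitG _ _ _ _ _ Wx) IH.
Qed.

(** The endomorphism [u |-> R(u, z) w], acting on row vectors from the right, whose trace is the
    Ricci curvature. *)
Definition ricci_mx x z w : 'M[R]_n := \matrix_i riemann G x (basis_vec i) z w.

Lemma ricci_mxE x u z w : W x -> u *m ricci_mx x z w = riemann G x u z w.
Proof.
move=> Wx; rewrite mulmx_sum_row [in RHS](basis_sum u) riemann_suml //.
by apply: eq_bigr => i _; rewrite rowK.
Qed.

Lemma ricci_trace x z w : ricci G x z w = \tr (ricci_mx x z w).
Proof. by apply: eq_bigr => i _; rewrite [RHS]mxE. Qed.

Lemma ricci_linear x z a v w : W x ->
  ricci G x z (a *: v + w) = a * ricci G x z v + ricci G x z w.
Proof.
move=> Wx; rewrite /ricci big_distrr /= -big_split /=; apply: eq_bigr => i _.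
rewrite (riemann_linear_r oW sG symG unitG _ _ _ _ _ Wx).
have E (p q : 'rV[R]_n) : (a *: p + q) 0 i = a * p 0 i + q 0 i by rewrite !mxE.
exact: E.
Qed.

Lemma ricci_row x z w : W x ->
  (\row_j ricci G x z (basis_vec j)) *m w^T = (ricci G x z w)%:M.
Proof.
move=> Wx; apply/rowP => k; rewrite (ord1 k) !mxE eqxx mulr1n [in RHS](basis_sum w).
have r0 : ricci G x z 0 = 0.
  by have := ricci_linear z (-1) 0 0 Wx; rewrite scaler0 addr0 mulN1r addNr.
transitivity (\sum_j w 0 j * ricci G x z (basis_vec j)).
  by apply: eq_bigr => j _; rewrite !mxE mulrC.
have rD p q : ricci G x z (p + q) = ricci G x z p + ricci G x z q.
  by rewrite -{1}(scale1r p) ricci_linear // mul1r.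
have rZ a p : ricci G x z (a *: p) = a * ricci G x z p.
  by rewrite -[a *: p]addr0 ricci_linear // r0 addr0.
rewrite (big_morph _ rD r0); apply: eq_bigr => j _; by rewrite rZ.
Qed.

Lemma riemann_same x u w : W x -> riemann G x u u w = 0.
Proof.
move=> Wx; have := riemannC oW sG symG unitG u u w Wx.
move: (riemann _ _ _ _ _) => r /rowP rN; apply/rowP => k; have := rN k.
by rewrite !mxE; lra.
Qed.

End Ricci.

Section RicciSurface.
Context {R : realType} {W : set 'rV[R]_3} {G : 'rV[R]_3 -> 'M[R]_3}.
Hypotheses (oW : open W) (sG : smooth_on W G)
  (symG : forall x, W x -> (G x)^T = G x) (unitG : forall x, W x -> G x \in unitmx).
Context {x : 'rV[R]_3} {J : 'M[R]_(2, 3)} {xi : 'rV[R]_3} {g : 'M[R]_2} {e : 'I_2 -> 'rV[R]_3}.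
Hypotheses (Wx : W x) (gE : g = J *m G x *m J^T) (eE : forall i, e i = basis_vec i *m J)
  (unitg : g \in unitmx) (xi1 : inner (G x) xi xi = 1) (xiJ : forall X, inner (G x) xi (X *m J) = 0).

Let skew := riemann_skew oW sG symG unitG.
Let pair := riemann_pair oW sG symG unitG.
Let antisym := riemannC oW sG symG unitG.

Lemma ricci_frame z w : ricci G x z w =
  \sum_i \sum_j invmx g i j * inner (G x) (riemann G x (e i) z w) (e j)
  + inner (G x) (riemann G x xi z w) xi.
Proof.
have ug := unitg; rewrite gE in ug.
rewrite ricci_trace (frame_trace (symG Wx) ug xi1 xiJ) -gE.
rewrite (ricci_mxE oW sG symG unitG _ _ _ Wx); congr (_ + _).
apply: eq_bigr => i _; apply: eq_bigr => j _.
by rewrite (ricci_mxE oW sG symG unitG _ _ _ Wx) !eE.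
Qed.

(** The normal direction contributes R(xi, xi) = 0. Skew symmetry turns the tangential sum into the
    curvature trace of the bitension field, whence the sign. *)
Lemma ricci_normal : ricci G x xi xi =
  - \sum_i \sum_j invmx g i j * inner (G x) (riemann G x (e i) xi (e j)) xi.
Proof.
rewrite ricci_frame [X in _ + X](_ : _ = 0) ?addr0; last first.
  by rewrite (riemann_same oW sG symG unitG) ?inner0l.
rewrite -sumrN; apply: eq_bigr => i _; rewrite -sumrN; apply: eq_bigr => j _.
by rewrite -mulrN skew.
Qed.

(** The hypothesis is Codazzi's equation of an umbilical surface. Its contraction is 2 dH - dH, the
    factor 2 being the dimension of the surface; the symmetries of the curvature bring both traces
    of the conclusion to this contraction, up to sign. *)
Lemma ricci_tangent (dH : 'I_2 -> R) (k : 'I_2) :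
  (forall i j, riemann G x (e i) (e j) xi = dH j *: e i - dH i *: e j) ->
  ricci G x xi (e k) = dH k /\
  \sum_i \sum_j invmx g i j * inner (G x) (riemann G x (e i) xi (e j)) (e k) = - dH k.
Proof.
move=> codazzi.
have symg : g^T = g by rewrite gE !trmx_mul trmxK symG // mulmxA.
have ge i j : inner (G x) (e i) (e j) = inner g (basis_vec i) (basis_vec j).
  by rewrite !eE gE /inner trmx_mul !mulmxA.
have S : \sum_i \sum_j invmx g i j * inner (G x) (riemann G x (e j) (e k) xi) (e i) = dH k.
  under eq_bigr => i _ do under eq_bigr => j _ do
    rewrite codazzi innerBl !innerZl !ge mulrBr.
  under eq_bigr => i _ do rewrite sumrB.
  rewrite sumrB.
  have T1 := trace_inner symg unitg.
  have T2 := trace_dualC (V := R^o) symg unitg dH (basis_vec k).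
  have Tk : \sum_i (basis_vec k : 'rV[R]_2) 0 i *: (dH i : R^o) = dH k.
    rewrite (bigD1 k) //= big1 ?mxE ?eqxx ?scale1r ?addr0 // => i ik.
    by rewrite mxE (negbTE ik) andbF scale0r.
  rewrite {}Tk in T2.
  rewrite (_ : \sum_i _ = dH k * 2%:R); last first.
    rewrite -T1 big_distrr /=; apply: eq_bigr => i _; rewrite big_distrr /=.
    by apply: eq_bigr => j _; rewrite mulrCA [inner g (basis_vec j) _]innerC.
  rewrite (_ : \sum_i _ = dH k); last first.
    rewrite -[RHS]T2; apply: eq_bigr => i _; apply: eq_bigr => j _.
    by rewrite -[RHS]/(_ * (_ * _)) [inner g (basis_vec k) _]innerC // [dH j * _]mulrC.
  by ring.
split.
  rewrite ricci_frame [X in _ + X](_ : _ = 0) ?addr0; last first.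
    by rewrite (riemann_same oW sG symG unitG) ?inner0l.
  rewrite -[RHS]S; apply: eq_bigr => i _; apply: eq_bigr => j _; congr (_ * _).
  rewrite pair // skew //.
  by rewrite antisym // innerNl opprK.
rewrite -[in RHS]S -sumrN; apply: eq_bigr => i _; rewrite -sumrN; apply: eq_bigr => j _.
rewrite -mulrN; congr (_ * _).
by rewrite pair // skew //.
Qed.

End RicciSurface.

(** * Conformal change in dimension two *)

(** Uniqueness of the Levi-Civita connection: [a X Y Z] stands for the product of the derivative of
    Y along X with Z, [b X Y Z] for the derivative along X of the product of Y and Z. The hypotheses
    are absence of torsion and metric compatibility. *)
Lemma koszul_algebra (R : realType) (T : Type) (a b : T -> T -> T -> R) X Y Z :
  (forall X Y Z, a X Y Z = a Y X Z) ->
  (forall X Y Z, b X Y Z = a X Y Z + a X Z Y) ->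
  2^-1 * (b X Y Z + b Y X Z - b Z X Y) = a X Y Z.
Proof.
move=> aC bE; by rewrite !bE (aC Y X Z) (aC Z X Y) (aC Z Y X); field.
Qed.

Lemma levi_civita_cst (R : realType) (n : nat) (G : 'rV[R]_n -> 'M[R]_n) (X Y x : 'rV[R]_n) :
  levi_civita G (cst X) (cst Y) x = christoffel_vec G x X Y.
Proof. by rewrite /levi_civita /nabla_along derive_cst derive_id add0r. Qed.

Section Conformal.
Context {R : realType} {O : set 'rV[R]_2} {g : 'rV[R]_2 -> 'M[R]_2} {rho : 'rV[R]_2 -> R^o}.
Hypotheses (oO : open O) (sg : smooth_on O g)
  (symg : forall x, O x -> (g x)^T = g x) (unitg : forall x, O x -> g x \in unitmx)
  (srho : smooth_on O rho) (rho0 : forall x, O x -> rho x != 0).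
Implicit Types (x u v w : 'rV[R]_2).

Let gbar x : 'M[R]_2 := rho x *: g x.

Let sgbar : smooth_on O gbar.
Proof.
apply/(smooth_mxP oO) => i j.
apply: (@smooth_eq _ _ _ oO _ (fun x => rho x * g x i j : R^o)).
  by move=> x _; rewrite mxE.
exact: (smoothM oO srho ((smooth_mxP oO g).1 sg i j)).
Qed.

Lemma derive_inner_cst (h : 'rV[R]_2 -> 'M[R]_2) x u v w : smooth_on O h -> O x ->
  'D_w (fun y => inner (h y) u v : R^o) x = inner ('D_w h x) u v.
Proof.
move=> sh Ox.
have E := derive_inner (smooth_differentiable sh Ox) (differentiable_cst u x) (differentiable_cst v x) w.
by rewrite (derive_cst u x w) (derive_cst v x w) inner0l inner0r !addr0 in E.
Qed.

Lemma inner_derive_conformal x u v w : O x ->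
  inner ('D_w gbar x) u v = 'D_w rho x * inner (g x) u v + rho x * inner ('D_w g x) u v.
Proof.
move=> Ox.
have sc (z : 'rV[R]_2) : smooth_on O (fun=> z) := @smooth_cst R 2 O _ z.
have si := smooth_inner oO sg (sc u) (sc v).
have E := deriveMR w (smooth_differentiable srho Ox) (smooth_differentiable si Ox).
rewrite -(derive_inner_cst u v w sgbar Ox) -(derive_inner_cst u v w sg Ox) [RHS]addrC [X in _ + X]mulrC.
apply: etrans E; congr ('D_w _ x); apply/funext => y; exact: innerZm.
Qed.

(** By Koszul's formula, the difference of the two Christoffel vectors of u and v has product with w
    equal to (drho(u) g(v,w) + drho(v) g(u,w) - drho(w) g(u,v)) / (2 rho). Its trace is (1 + 1 - 2)
    drho(w) / (2 rho) = 0, where the last 2 is the dimension. *)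
Lemma trace_christoffel_conformal x : O x ->
  trace_metric (g x) (fun i j => christoffel_vec gbar x (basis_vec i) (basis_vec j)) =
  trace_metric (g x) (fun i j => christoffel_vec g x (basis_vec i) (basis_vec j)).
Proof.
move=> Ox; have [T [TD TC TE]] := koszul_abstract oO sg symg unitg Ox.
have sbar y : O y -> (gbar y)^T = gbar y by move=> Oy; rewrite linearZ /= symg.
have ubar y : O y -> gbar y \in unitmx.
  by move=> Oy; rewrite unitmxZ ?unitg // unitfE rho0.
have kos u v w := koszul sgbar sbar ubar u v w Ox.
(* [r] is the differential of [rho], abstracted so that [field] and [ring] meet no derivative. *)
have [r [rE rL]] : exists r : 'rV[R]_2 -> R,
    (forall w u v, inner ('D_w gbar x) u v = r w * inner (g x) u v + rho x * inner (T w) u v) /\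
    (forall w, r w = \sum_i w 0 i * r (basis_vec i)).
  exists (fun w => 'D_w rho x); split=> [w u v|w].
    by rewrite inner_derive_conformal // TD.
  exact: derive_basis (smooth_differentiable srho Ox).
have {}kos u v w : inner (g x) (christoffel_vec gbar x u v) w =
    inner (g x) (christoffel_vec g x u v) w
    + (2 * rho x)^-1 * (r u * inner (g x) v w + r v * inner (g x) u w - r w * inner (g x) u v).
  have K := etrans (kos u v w) (congr2 (fun a b => 2^-1 * (a - b))
    (congr2 (fun a b => a + b) (rE u v w) (rE v u w)) (rE w u v)).
  apply: (mulfI (rho0 Ox)); apply: etrans (esym (innerZm _ _ _ _)) (etrans K _).
  rewrite TE mulrDr.
  move: (inner (g x) v w) (inner (g x) u w) (inner (g x) u v) => a b c.
  move: (inner (T u) v w) (inner (T v) u w) (inner (T w) u v) => a' b' c'.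
  by field; exact: rho0.
apply/eqP; rewrite -subr_eq0; apply/eqP; apply: (inner_eq0 (unitg Ox)) => w.
rewrite innerBl !inner_trace_metric -sumrB.
pose s1 i j : R := invmx (g x) i j * (inner (g x) (basis_vec j) w * r (basis_vec i)).
pose s2 i j : R := invmx (g x) i j * (inner (g x) (basis_vec i) w * r (basis_vec j)).
pose s3 i j : R := invmx (g x) i j * inner (g x) (basis_vec i) (basis_vec j).
have S1 : \sum_i \sum_j s1 i j = r w.
  exact: etrans (trace_dual (V := R^o) (unitg Ox) (fun i => r (basis_vec i)) w) (esym (rL w)).
have S2 : \sum_i \sum_j s2 i j = r w.
  exact: etrans (trace_dualC (V := R^o) (symg Ox) (unitg Ox) (fun i => r (basis_vec i)) w) (esym (rL w)).
have S3 : \sum_i \sum_j s3 i j = 2%:R := trace_inner (symg Ox) (unitg Ox).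
transitivity ((2 * rho x)^-1 *
    (\sum_i \sum_j s1 i j + \sum_i \sum_j s2 i j - r w * \sum_i \sum_j s3 i j)); last first.
  by rewrite S1 S2 S3; ring.
rewrite [r w * _]big_distrr -big_split -sumrB big_distrr; apply: eq_bigr => i _ /=.
rewrite [r w * _]big_distrr -big_split -!sumrB big_distrr; apply: eq_bigr => j _ /=.
rewrite kos /s1 /s2 /s3.
move: (inner (g x) (christoffel_vec g x (basis_vec i) (basis_vec j)) w) => a.
move: (inner (g x) (basis_vec j) w) (inner (g x) (basis_vec i) w) => b c.
move: (inner (g x) (basis_vec i) (basis_vec j)) => d.
ring.
Qed.

(** A common form for the two operators at issue: the metric enters the second fundamental form and
    the rough Laplacian through the trace and a linear function [T] of its Christoffel vectors,
    namely the differential of the map and the covariant derivative of the tension field. *)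
Lemma trace_conformal (n : nat) (S : 'I_2 -> 'I_2 -> 'rV[R]_n) (T : 'rV[R]_2 -> 'rV[R]_n) x :
  O x -> (forall a u v, T (a *: u + v) = a *: T u + T v) ->
  trace_metric (gbar x) (fun i j => S i j - T (christoffel_vec gbar x (basis_vec i) (basis_vec j))) =
  (rho x)^-1 *: trace_metric (g x) (fun i j =>
    S i j - T (christoffel_vec g x (basis_vec i) (basis_vec j))).
Proof.
move=> Ox TL.
have E h : trace_metric (g x) (fun i j => S i j - T (h i j)) =
    trace_metric (g x) S - T (trace_metric (g x) h).
  by rewrite trace_metricD trace_metricN (trace_metric_linear _ _ TL).
have gE : gbar x = (rho x)^-1^-1 *: g x by rewrite invrK.
have r0 : (rho x)^-1 != 0 by rewrite invr_eq0 rho0.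
have C := trace_christoffel_conformal Ox.
apply: etrans (congr1 (fun B => trace_metric B _) gE) (etrans (trace_metricZ _ r0 (unitg Ox)) _).
apply: congr1; apply: etrans (E _) (etrans _ (esym (E _))).
exact: (congr1 (fun z => trace_metric (g x) S - T z) C).
Qed.

End Conformal.

(** * Totally umbilical surfaces in coordinates *)

Lemma nabla_along_cst (R : realType) (m n : nat) (G : 'rV[R]_n -> 'M[R]_n)
    (F : 'rV[R]_m -> 'rV[R]_n) X U x :
  nabla_along G F X U x = nabla_along G F (cst (X x)) U x.
Proof. by []. Qed.

Section HessianAlgebra.
Context {R : realType} (B : 'M[R]_3) (n p q z s k : 'rV[R]_3) (a b c w t : R).

(** The Hessian of a field u xi once nabla xi = - H dF is substituted: [n] is the normal, [p] and
    [q] are coordinate tangent vectors, [z] is the covariant derivative of such a vector and [s] the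
    image of the Christoffel vector. The tangential parts of [z] and [s] agree, so they cancel in
    the second lemma. *)
Let hess := (a *: n - b *: p - (c *: q + w *: z)) - (t *: n - w *: s).

Lemma inner_hess_normal zn : inner B n n = 1 -> inner B p n = 0 -> inner B q n = 0 ->
  inner B s n = 0 -> inner B z n = zn -> inner B hess n = a - t - w * zn.
Proof.
move=> nn pn qn sn <-.
rewrite /hess innerBl innerBl innerBl innerBl innerDl !innerZl nn pn qn sn.
by ring.
Qed.

Lemma inner_hess_tangent pk qk zk : inner B n k = 0 -> inner B p k = pk ->
  inner B q k = qk -> inner B z k = zk -> inner B s k = zk ->
  inner B hess k = - (pk * b) - qk * c.
Proof.
move=> nk <- <- <- sk.
rewrite /hess innerBl innerBl innerBl innerBl innerDl !innerZl nk sk.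
by ring.
Qed.

End HessianAlgebra.

(* F parametrizes the surface by O, G is the metric of the ambient coordinate
   domain W, g the induced metric, xi the unit normal, and the shape operator is
   the multiplication by H. *)
Record umbilical_patch {R : realType} (O : set 'rV[R]_2) (W : set 'rV[R]_3)
    (G : 'rV[R]_3 -> 'M[R]_3) (F xi : 'rV[R]_2 -> 'rV[R]_3) (g : 'rV[R]_2 -> 'M[R]_2)
    (H : 'rV[R]_2 -> R^o) : Prop := UmbilicalPatch {
  patch_oW : open W;
  patch_sG : smooth_on W G;
  patch_symG : forall x, W x -> (G x)^T = G x;
  patch_unitG : forall x, W x -> G x \in unitmx;
  patch_oO : open O;
  patch_sF : smooth_on O F;
  patch_FO : forall x, O x -> W (F x);
  patch_sxi : smooth_on O xi;
  patch_sg : smooth_on O g;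
  patch_gE : forall x, O x -> g x = 'J F x *m G (F x) *m ('J F x)^T;
  patch_posg : forall x, O x -> forall v, v != 0 -> 0 < inner (g x) v v;
  patch_xi1 : forall x, O x -> inner (G (F x)) (xi x) (xi x) = 1;
  patch_xiJ : forall x, O x -> forall X, inner (G (F x)) (xi x) (X *m 'J F x) = 0;
  patch_umb : forall x, O x -> forall X,
    H x *: 'D_X F x = - nabla_along G F (cst X) xi x }.

Section LocalSurface.
Context {R : realType} {O : set 'rV[R]_2} {W : set 'rV[R]_3}
  {G : 'rV[R]_3 -> 'M[R]_3} {F xi : 'rV[R]_2 -> 'rV[R]_3} {g : 'rV[R]_2 -> 'M[R]_2}
  {H f : 'rV[R]_2 -> R^o}.
Hypothesis patch : umbilical_patch O W G F xi g H.
Implicit Types (x X Y Z : 'rV[R]_2).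

Let oW := patch_oW patch.
Let sG := patch_sG patch.
Let symG := patch_symG patch.
Let unitG := patch_unitG patch.
Let oO := patch_oO patch.
Let sF := patch_sF patch.
Let FO := patch_FO patch.
Let sxi := patch_sxi patch.
Let sg := patch_sg patch.
Let gE := patch_gE patch.
Let posg := patch_posg patch.
Let xi1 := patch_xi1 patch.
Let xiJ := patch_xiJ patch.
Let umb := patch_umb patch.

Lemma symg x : O x -> (g x)^T = g x.
Proof. by move=> Ox; rewrite gE // !trmx_mul trmxK symG ?mulmxA //; exact: FO. Qed.

Lemma unitg x : O x -> g x \in unitmx.
Proof. by move=> Ox; exact: posdef_unitmx (posg Ox). Qed.

Let dF x : O x -> differentiable F x. Proof. exact: smooth_differentiable. Qed.

Lemma jacE x X : O x -> 'D_X F x = X *m 'J F x.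
Proof. by move=> Ox; rewrite deriveEjacobian //; exact: dF. Qed.

Lemma pullback_metric x X Y : O x ->
  inner (g x) X Y = inner (G (F x)) ('D_X F x) ('D_Y F x).
Proof.
move=> Ox; rewrite (jacE X Ox) (jacE Y Ox) gE //.
by rewrite /inner trmx_mul !mulmxA.
Qed.

Lemma xi_tangent x X : O x -> inner (G (F x)) (xi x) ('D_X F x) = 0.
Proof. by move=> Ox; rewrite jacE // xiJ. Qed.

Lemma tangent_xi x X : O x -> inner (G (F x)) ('D_X F x) (xi x) = 0.
Proof. by move=> Ox; rewrite innerC ?xi_tangent // symG //; exact: FO. Qed.

Lemma nabla_F_sym x X Y : O x ->
  nabla_along G F (cst X) ('D_Y F) x = nabla_along G F (cst Y) ('D_X F) x.
Proof.
move=> Ox.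
have E := congr2 (fun a b : 'rV[R]_3 => a + b) (smooth_schwarz_mx X Y oO sF Ox)
  (christoffel_vecC oW sG symG unitG ('D_X F x) ('D_Y F x) (FO Ox)).
exact E.
Qed.

(** The tangential part of the ambient connection is torsion-free, and differentiating the induced
    metric shows it to be compatible with it; it is therefore the Levi-Civita connection of [g]. *)
Lemma nabla_F_tangent x X Y Z : O x ->
  inner (G (F x)) (nabla_along G F (cst X) ('D_Y F) x) ('D_Z F x) =
  inner (g x) (christoffel_vec g x X Y) Z.
Proof.
move=> Ox; have [T [TD TC TE]] := koszul_abstract oO sg symg unitg Ox.
rewrite TE; symmetry.
apply: (@koszul_algebra R _
  (fun X Y Z => inner (G (F x)) (nabla_along G F (cst X) ('D_Y F) x) ('D_Z F x))
  (fun X => inner (T X))) => {}X {}Y {}Z.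
  by rewrite (nabla_F_sym X Y Ox).
rewrite -TD; cbv beta.
have DF V := smooth_differentiable (smooth_derive V sF) Ox.
have E1 := derive_inner_along oW sG symG unitG sF FO X Ox (DF Y) (DF Z).
have E2 := derive_inner (smooth_differentiable sg Ox) (differentiable_cst Y x) (differentiable_cst Z x) X.
have E3 := eq_open_derive X oO Ox (fun y Oy => pullback_metric Y Z Oy).
rewrite (derive_cst Y x X) (derive_cst Z x X) inner0l inner0r !addr0 in E2.
have E4 := etrans (esym E2) (etrans E3 E1).
rewrite E4; congr (_ + _); apply: innerC; exact: symG (FO Ox).
Qed.

(** Differentiating the relation that ['D_Y F] is orthogonal to [xi] moves the derivative onto [xi],
    where umbilicity applies. *)
Lemma nabla_F_normal x X Y : O x ->
  inner (G (F x)) (nabla_along G F (cst X) ('D_Y F) x) (xi x) = H x * inner (g x) X Y.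
Proof.
move=> Ox.
have E1 := derive_inner_along oW sG symG unitG sF FO X Ox
  (smooth_differentiable (smooth_derive Y sF) Ox) (smooth_differentiable sxi Ox).
have E2 := eq_open_derive X oO Ox (fun y Oy => tangent_xi Y Oy).
have E3 := etrans (esym E2) E1; rewrite (derive_cst 0 x X) in E3.
move: E3; have -> : nabla_along G F (cst X) xi x = - (H x *: 'D_X F x) by rewrite umb // opprK.
rewrite innerNr innerZr -(pullback_metric Y X Ox) (innerC X Y (symg Ox)) => /esym/eqP.
by rewrite subr_eq0 => /eqP.
Qed.

Lemma frame_eq x (v w : 'rV[R]_3) : O x ->
  (forall X, inner (G (F x)) v ('D_X F x) = inner (G (F x)) w ('D_X F x)) ->
  inner (G (F x)) v (xi x) = inner (G (F x)) w (xi x) -> v = w.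
Proof.
move=> Ox vwF vwxi; apply/eqP; rewrite -subr_eq0; apply/eqP.
apply: (frame_eq0 (symG (FO Ox)) _ (xi1 Ox) (xiJ Ox)).
- by rewrite -gE // unitg.
- by move=> X; rewrite -jacE // innerBl vwF subrr.
- by rewrite innerBl vwxi subrr.
Qed.

(** Gauss's formula for an umbilical surface. *)
Lemma nabla_F x X Y : O x -> nabla_along G F (cst X) ('D_Y F) x =
  'D_(christoffel_vec g x X Y) F x + (H x * inner (g x) X Y) *: xi x.
Proof.
move=> Ox; apply: (frame_eq Ox) => [Z|].
  rewrite nabla_F_tangent // innerDl innerZl xi_tangent // mulr0 addr0.
  exact: pullback_metric.
by rewrite nabla_F_normal // innerDl innerZl tangent_xi // xi1 // mulr1 add0r.
Qed.

Lemma nabla_F_sub x X Y : O x ->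
  nabla_along G F (cst X) ('D_Y F) x - 'D_(christoffel_vec g x X Y) F x =
  (H x * inner (g x) X Y) *: xi x.
Proof.
have sub_of_add (p q r : 'rV[R]_3) : p = q + r -> p - q = r by move=> ->; rewrite addrC addKr.
by move=> Ox; exact: sub_of_add (nabla_F X Y Ox).
Qed.

Lemma second_fundamental_form_eq x X Y : O x ->
  second_fundamental_form g G F (cst X) (cst Y) x = (H x * inner (g x) X Y) *: xi x.
Proof.
by move=> Ox; rewrite /second_fundamental_form levi_civita_cst; exact: nabla_F_sub.
Qed.

(** Nothing is assumed on the regularity of [H]. Pairing the umbilicity relation with one nonzero
    tangent vector ['D_e0 F] exhibits [H] as a quotient of smooth functions. *)
Lemma smooth_umbilicity : smooth_on O H.
Proof.
pose e0 : 'rV[R]_2 := basis_vec 0.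
have g0 y : O y -> inner (g y) e0 e0 != 0.
  move=> Oy; rewrite gt_eqF // posg //; apply/eqP => /rowP /(_ 0).
  by rewrite !mxE /= => /eqP; rewrite oner_eq0.
have sDF := smooth_derive e0 sF.
apply: (@smooth_eq _ _ _ oO _ (fun y =>
  - inner (G (F y)) (nabla_along G F (cst e0) xi y) ('D_e0 F y) * (inner (g y) e0 e0)^-1 : R^o)).
  move=> y Oy; rewrite -innerNl -umb // innerZl -pullback_metric // mulfK //.
  exact: g0.
apply: (smoothM oO).
  apply: (smoothN oO); apply: (smooth_inner oO) => //.
    exact: (smooth_comp_mx oW oO sF FO sG).
  exact: (smooth_nabla oW sG unitG oO sF FO e0 sxi).
apply: (smoothV oO); first exact: g0.
by apply: (smooth_inner oO) => //; exact: smooth_cst.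
Qed.

(** * Tension and bitension fields of the conformal immersion *)

Hypotheses (sf : smooth_on O f) (fpos : forall x, O x -> 0 < f x).

Let gbar x : 'M[R]_2 := (f x)^-1 *: g x.
Let u x : R^o := 2 * (f x * H x).
Let e (i : 'I_2) : 'rV[R]_2 := basis_vec i.

Let f0 x : O x -> f x != 0. Proof. by move=> Ox; rewrite gt_eqF // fpos. Qed.

Let trace_gbar (S : 'I_2 -> 'I_2 -> 'rV[R]_3) (T : 'rV[R]_2 -> 'rV[R]_3) x :
  O x -> (forall a Y Z, T (a *: Y + Z) = a *: T Y + T Z) ->
  trace_metric (gbar x) (fun i j => S i j - T (christoffel_vec gbar x (e i) (e j))) =
  f x *: trace_metric (g x) (fun i j => S i j - T (christoffel_vec g x (e i) (e j))).
Proof.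
move=> Ox TL.
have fV0 y : O y -> (f y)^-1 != 0 by move=> Oy; rewrite invr_eq0 f0.
have E := trace_conformal oO sg symg unitg (smoothV oO f0 sf) fV0 S Ox TL.
by rewrite invrK in E.
Qed.

Lemma tension_conformal x : O x -> tension gbar G F x = u x *: xi x.
Proof.
move=> Ox.
have E i j : second_fundamental_form gbar G F (cst (e i)) (cst (e j)) x =
    nabla_along G F (cst (e i)) ('D_(e j) F) x - 'D_(christoffel_vec gbar x (e i) (e j)) F x.
  by rewrite /second_fundamental_form levi_civita_cst.
have DL a Y Z := derive_linear Y Z a (dF Ox).
have T := trace_gbar (fun i j => nabla_along G F (cst (e i)) ('D_(e j) F) x) Ox DL.
have E1 := eq_trace_metric (gbar x) E.
cbv beta in T, E1.
apply: (etrans E1).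
apply: (etrans T).
have E2 i j : nabla_along G F (cst (e i)) ('D_(e j) F) x - 'D_(christoffel_vec g x (e i) (e j)) F x
    = (H x * inner (g x) (e i) (e j)) *: xi x.
  exact: nabla_F_sub.
apply: etrans (congr1 (fun z => f x *: z) (eq_trace_metric _ E2)) _.
have -> : trace_metric (g x) (fun i j => (H x * inner (g x) (e i) (e j)) *: xi x) = (H x * 2%:R) *: xi x.
  rewrite -(trace_inner (symg Ox) (unitg Ox)) big_distrr scaler_suml; apply: eq_bigr => i _.
  rewrite big_distrr scaler_suml; apply: eq_bigr => j _ /=.
  by rewrite scalerA mulrCA.
by rewrite scalerA /u; congr (_ *: _); ring.
Qed.

Let su : smooth_on O u.
Proof.
apply: (smoothM oO); first exact: (@smooth_cst R 2 O R^o 2).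
by apply: (smoothM oO) => //; exact: smooth_umbilicity.
Qed.

Let tau := tension gbar G F.

Let tauE y : O y -> u y *: xi y = tau y. Proof. by move=> Oy; rewrite /tau tension_conformal. Qed.

Let stau : smooth_on O tau.
Proof.
apply: (smooth_eq oO tauE); apply/(smooth_mxP oO) => i j.
apply: (@smooth_eq _ _ _ oO _ (fun y => u y * xi y i j : R^o)).
  by move=> y _; rewrite mxE.
exact: (smoothM oO su ((smooth_mxP oO xi).1 sxi i j)).
Qed.

Let v y : R^o := u y * H y.

Let sv : smooth_on O v. Proof. exact: (smoothM oO su smooth_umbilicity). Qed.

Let nabla_xi y Y : O y -> nabla_along G F (cst Y) xi y = - (H y *: 'D_Y F y).
Proof. by move=> Oy; rewrite umb // opprK. Qed.

Let nabla_tau y Y : O y ->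
  nabla_along G F (cst Y) tau y = 'D_Y u y *: xi y - v y *: 'D_Y F y.
Proof.
move=> Oy; rewrite -(nabla_eq oO Y Oy tauE).
rewrite (nablaZ Y (smooth_differentiable su Oy) (smooth_differentiable sxi Oy)).
by rewrite nabla_xi // scalerN scalerA.
Qed.

Let nabla2_tau y Y Z : O y ->
  nabla_along G F (cst Z) (nabla_along G F (cst Y) tau) y =
  'D_Z ('D_Y u) y *: xi y - ('D_Y u y * H y) *: 'D_Z F y
  - ('D_Z v y *: 'D_Y F y + v y *: nabla_along G F (cst Z) ('D_Y F) y).
Proof.
move=> Oy.
have sDu := smooth_derive Y su; have sDF := smooth_derive Y sF.
have d1 := smooth_differentiable sDu Oy; have d2 := smooth_differentiable sxi Oy.
have d3 := smooth_differentiable sv Oy; have d4 := smooth_differentiable sDF Oy.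
have E1 := nablaZ (G := G) (F := F) Z d1 d2.
have E2 := nablaZ (G := G) (F := F) Z (differentiableN d3) d4.
have s1 : smooth_on O (fun z => 'D_Y u z *: xi z).
  apply/(smooth_mxP oO) => i j.
  apply: (@smooth_eq _ _ _ oO _ (fun y => 'D_Y u y * xi y i j : R^o)).
    by move=> z _; rewrite mxE.
  exact: (smoothM oO sDu ((smooth_mxP oO xi).1 sxi i j)).
have s2 : smooth_on O (fun z => (- v) z *: 'D_Y F z).
  apply/(smooth_mxP oO) => i j.
  apply: (@smooth_eq _ _ _ oO _ (fun z => - v z * 'D_Y F z i j : R^o)).
    by move=> z _; rewrite mxE.
  exact: (smoothM oO (smoothN oO sv) ((smooth_mxP oO ('D_Y F)).1 sDF i j)).
have E3 := nablaD (G := G) (F := F) Z (smooth_differentiable s1 Oy) (smooth_differentiable s2 Oy).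
have TE z : O z -> nabla_along G F (cst Y) tau z = 'D_Y u z *: xi z + (- v) z *: 'D_Y F z.
  by move=> Oz; rewrite nabla_tau // -scaleNr.
apply: (etrans (nabla_eq oO Z Oy TE)); apply: (etrans E3).
apply: (etrans (congr2 (fun a b => a + b) E1 E2)).
have DN : 'D_Z (- v) y = - 'D_Z v y by apply: deriveN; exact: diff_derivable.
rewrite (nabla_xi Z Oy) DN scalerN scalerA scaleNr.
by rewrite [(- v) y *: _]scaleNr -opprD.
Qed.

Let codazzi_algebra (a b h : R) (p q z : 'rV[R]_3) :
  - a *: p + - h *: z - (- b *: q + - h *: z) = b *: q - a *: p.
Proof. by apply/rowP => k; rewrite !mxE; ring. Qed.

(** The curvature applied to [xi] is the commutator of its second covariant derivatives. As nabla xi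
    = - H dF, these contain the derivatives of H and the second derivatives of F, and the latter
    cancel by symmetry. *)
Lemma codazzi x i j : O x ->
  riemann G (F x) ('D_(e i) F x) ('D_(e j) F x) (xi x) =
  'D_(e j) H x *: 'D_(e i) F x - 'D_(e i) H x *: 'D_(e j) F x.
Proof.
move=> Ox; have sH := smooth_umbilicity.
have sNH : smooth_on O (fun y => - H y : R^o) := smoothN oO sH.
have E a b : nabla_along G F (cst (e a)) (nabla_along G F (cst (e b)) xi) x =
    - 'D_(e a) H x *: 'D_(e b) F x + - H x *: nabla_along G F (cst (e a)) ('D_(e b) F) x.
  have XE z : O z -> nabla_along G F (cst (e b)) xi z = - H z *: 'D_(e b) F z.
    by move=> Oz; rewrite nabla_xi // scaleNr.
  apply: (etrans (nabla_eq oO (e a) Ox XE)).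
  apply: (etrans (nablaZ (G := G) (F := F) (e a) (smooth_differentiable sNH Ox)
    (smooth_differentiable (smooth_derive (e b) sF) Ox))).
  congr (_ *: _ + _); apply: deriveN; apply: diff_derivable; exact: smooth_differentiable sH Ox.
apply: (etrans (esym (nabla_curvature oW sG unitG (e i) (e j) oO sF FO sxi Ox))).
apply: (etrans (congr2 (fun a b => a - b) (E i j) (E j i))).
apply: (etrans (congr1 (fun z => - 'D_(e i) H x *: 'D_(e j) F x + - H x *: z -
  (- 'D_(e j) H x *: 'D_(e i) F x + - H x *: nabla_along G F (cst (e j)) ('D_(e i) F) x))
  (nabla_F_sym (e i) (e j) Ox))).
exact: codazzi_algebra.
Qed.

Let D2 x i j := nabla_along G F (cst (e i)) (nabla_along G F (cst (e j)) tau) x.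
Let Q x i j := riemann G (F x) ('D_(e i) F x) (xi x) ('D_(e j) F x).

(** The rough Laplacian is multiplied by [f] by the two-dimensional argument; the curvature term,
    being a plain metric trace, is multiplied by [f] as well, and [u] leaves it by linearity. *)
Let bitensionE x : O x -> bitension gbar G F x =
  f x *: (trace_metric (g x) (fun i j => D2 x i j
      - nabla_along G F (cst (christoffel_vec g x (e i) (e j))) tau x)
    - u x *: trace_metric (g x) (Q x)).
Proof.
move=> Ox.
have E1 i j : nabla_along G F (cst (e i)) (nabla_along G F (cst (e j)) tau) x
    - nabla_along G F (levi_civita gbar (cst (e i)) (cst (e j))) tau x =
    D2 x i j - nabla_along G F (cst (christoffel_vec gbar x (e i) (e j))) tau x.
  have N1 := nabla_along_cst G F (levi_civita gbar (cst (e i)) (cst (e j))) tau x.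
  have N2 := congr1 (fun z => nabla_along G F (cst z) tau x) (levi_civita_cst gbar (e i) (e j) x).
  exact (congr1 (fun z => D2 x i j - z) (etrans N1 N2)).
have TL a Y Z := nabla_linear (G := G) sF a Y Z Ox (smooth_differentiable stau Ox).
have T := trace_gbar (D2 x) Ox TL.
have L0 p q : riemann G (F x) p 0 q = 0.
  by rewrite (riemannC oW sG symG unitG _ _ _ (FO Ox)) (riemann0l oW sG symG unitG _ _ (FO Ox)) oppr0.
have LZ p q a z : riemann G (F x) p (a *: z) q = a *: riemann G (F x) p z q.
  by rewrite -[a *: z]addr0 (riemann_linear_m oW sG symG unitG _ _ _ _ _ (FO Ox)) L0 addr0.
have E2 i j : riemann G (F x) ('D_(e i) F x) (tau x) ('D_(e j) F x) = u x *: Q x i j.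
  by rewrite -tauE // LZ.
have T2 : trace_metric (gbar x) (fun i j => u x *: Q x i j) = f x *: (u x *: trace_metric (g x) (Q x)).
  have fV0 : f x != 0 by exact: f0.
  rewrite (trace_metricZ _ fV0 (unitg Ox)); congr (_ *: _).
  rewrite /trace_metric scaler_sumr; apply: eq_bigr => i _; rewrite scaler_sumr.
  by apply: eq_bigr => j _; rewrite !scalerA mulrC.
have K := congr2 (fun a b => a - b) (etrans (eq_trace_metric (gbar x) E1) T)
  (etrans (eq_trace_metric (gbar x) E2) T2).
apply: (etrans K); cbv beta.
by rewrite [RHS]scalerBr.
Qed.

(** The Laplace-Beltrami operator of [g], not of [gbar]: the factor [f] has already been taken
    out. *)
Let laplacian_u x : R := \sum_i \sum_j invmx (g x) i j *
  ('D_(e i) ('D_(e j) u) x - 'D_(christoffel_vec g x (e i) (e j)) u x).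

(** The right-hand side, left to inference, has the shape of [hess]. *)
Let hessE x i j (Ox : O x) :
  D2 x i j - nabla_along G F (cst (christoffel_vec g x (e i) (e j))) tau x = _ :=
  congr2 (fun a b => a - b) (nabla2_tau (e j) (e i) Ox) (nabla_tau (christoffel_vec g x (e i) (e j)) Ox).

Let hess_normal x i j : O x ->
  inner (G (F x)) (D2 x i j - nabla_along G F (cst (christoffel_vec g x (e i) (e j))) tau x) (xi x) =
  'D_(e i) ('D_(e j) u) x - 'D_(christoffel_vec g x (e i) (e j)) u x
  - v x * (H x * inner (g x) (e i) (e j)).
Proof.
move=> Ox; apply: (etrans (congr1 (fun z => inner (G (F x)) z (xi x)) (hessE i j Ox))).
apply: inner_hess_normal; [exact: xi1|exact: tangent_xi..|exact: nabla_F_normal].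
Qed.

Let hess_tangent x i j k : O x ->
  inner (G (F x)) (D2 x i j - nabla_along G F (cst (christoffel_vec g x (e i) (e j))) tau x) ('D_(e k) F x) =
  - (inner (g x) (e i) (e k) * ('D_(e j) u x * H x)) - inner (g x) (e j) (e k) * 'D_(e i) v x.
Proof.
move=> Ox; apply: (etrans (congr1 (fun z => inner (G (F x)) z ('D_(e k) F x)) (hessE i j Ox))).
apply: (@inner_hess_tangent _ _ _ _ _ _ _ _ _ _ _ _ _ _ _ (inner (g x) (christoffel_vec g x (e i) (e j)) (e k))).
- exact: xi_tangent.
- exact: esym (pullback_metric _ _ Ox).
- exact: esym (pullback_metric _ _ Ox).
- exact: nabla_F_tangent.
- exact: esym (pullback_metric _ _ Ox).
Qed.

Let bitension_normal x : O x ->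
  inner (G (F x)) (bitension gbar G F x) (xi x) =
  f x * (laplacian_u x - 2 * u x * H x ^+ 2 + u x * ricci G (F x) (xi x) (xi x)).
Proof.
move=> Ox; rewrite bitensionE // innerZl innerBl innerZl !inner_trace_metric; congr (_ * _).
have RE := ricci_normal oW sG symG unitG (FO Ox) (gE Ox) (fun i => jacE (e i) Ox) (unitg Ox) (xi1 Ox) (xiJ Ox).
rewrite RE mulrN; congr (_ - _).
under eq_bigr => i _ do under eq_bigr => j _ do rewrite hess_normal // mulrBr.
under eq_bigr => i _ do rewrite sumrB.
rewrite sumrB; congr (_ - _).
transitivity (v x * H x * (\sum_i \sum_j invmx (g x) i j * inner (g x) (e i) (e j))).
  rewrite big_distrr; apply: eq_bigr => i _; rewrite big_distrr; apply: eq_bigr => j _ /=.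
  by move: (invmx (g x) i j) (inner (g x) (e i) (e j)) (H x) (v x) => a b c d; ring.
by rewrite (trace_inner (symg Ox) (unitg Ox)) /v; ring.
Qed.

(** The two Hessian terms contribute H du and d(uH), that is 2 H du + u dH; the contracted Codazzi
    equation removes u dH. *)
Let bitension_tangent x k : O x ->
  inner (G (F x)) (bitension gbar G F x) ('D_(e k) F x) = - (2 * f x * H x * 'D_(e k) u x).
Proof.
move=> Ox; rewrite bitensionE // innerZl innerBl innerZl !inner_trace_metric.
have [_ QE] := ricci_tangent oW sG symG unitG (FO Ox) (gE Ox) (fun i => jacE (e i) Ox) (unitg Ox)
  (xi1 Ox) (xiJ Ox) k (fun i j => codazzi i j Ox).
rewrite QE.
under eq_bigr => i _ do under eq_bigr => j _ do rewrite hess_tangent // mulrBr mulrN.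
under eq_bigr => i _ do rewrite sumrB sumrN.
rewrite sumrB sumrN.
have sumk (t : 'I_2 -> R) : \sum_i (e k) 0 i * t i = t k.
  rewrite (bigD1 k) //= big1 ?mxE ?eqxx ?mul1r ?addr0 // => i ik.
  by rewrite mxE (negbTE ik) andbF mul0r.
have S1 : \sum_i \sum_j invmx (g x) i j * (inner (g x) (e i) (e k) * ('D_(e j) u x * H x)) = 'D_(e k) u x * H x.
  exact: etrans (trace_dualC (V := R^o) (symg Ox) (unitg Ox) (fun j => 'D_(e j) u x * H x) (e k)) (sumk _).
have S2 : \sum_i \sum_j invmx (g x) i j * (inner (g x) (e j) (e k) * 'D_(e i) v x) = 'D_(e k) v x.
  exact: etrans (trace_dual (V := R^o) (unitg Ox) (fun i => 'D_(e i) v x) (e k)) (sumk _).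
rewrite S1 S2.
have sH := smooth_umbilicity.
have -> : 'D_(e k) v x = u x * 'D_(e k) H x + H x * 'D_(e k) u x.
  exact: deriveMR (e k) (smooth_differentiable su Ox) (smooth_differentiable sH Ox).
move: ('D_(e k) u x) ('D_(e k) H x) (H x) (f x) (u x) => a b c d q.
ring.
Qed.

Let bitension_eq0 x : O x ->
  bitension gbar G F x = 0 <->
  (forall k, H x * 'D_(e k) u x = 0) /\
  laplacian_u x - 2 * u x * H x ^+ 2 + u x * ricci G (F x) (xi x) (xi x) = 0.
Proof.
move=> Ox; have Bn := bitension_normal Ox; have Bt k := bitension_tangent k Ox.
split=> [B0|[tan0 nor0]].
  rewrite B0 inner0l in Bn; split=> [k|].
    have := Bt k; rewrite B0 inner0l => /esym /eqP; rewrite oppr_eq0 -!mulrA mulf_eq0 pnatr_eq0 /=.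
    by rewrite mulf_eq0 (negbTE (f0 Ox)) /= => /eqP.
  by move/esym/eqP: Bn; rewrite mulf_eq0 (negbTE (f0 Ox)) /= => /eqP.
apply: (frame_eq Ox) => [X|]; rewrite inner0l; last by rewrite Bn nor0 mulr0.
rewrite jacE // (basis_sum X) mulmx_suml inner_sumr big1 // => k _.
by rewrite -scalemxAl innerZr -jacE // Bt -!mulrA tan0 !mulr0 oppr0 mulr0.
Qed.

Lemma ricci_normal_tangent x : O x ->
  tangent_part (g x) (G (F x)) ('J F x) (ricci_op G (F x) (xi x)) = grad g H x.
Proof.
move=> Ox; rewrite /tangent_part /ricci_op /grad.
rewrite mulmxKV ?unitG //; last exact: FO.
congr (_ *m _); apply/rowP => k.
have [RE _] := ricci_tangent oW sG symG unitG (FO Ox) (gE Ox) (fun i => jacE (e i) Ox) (unitg Ox)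
  (xi1 Ox) (xiJ Ox) k (fun i j => codazzi i j Ox).
rewrite [RHS]mxE -RE -[X in _ = X]mulr1n.
have := ricci_row oW sG symG unitG (xi x) ('D_(e k) F x) (FO Ox).
move=> /matrixP /(_ 0 0); rewrite [RHS]mxE => <-.
rewrite (jacE (e k) Ox) trmx_mul mulmxA trmx_delta.
by rewrite -colE [RHS]mxE.
Qed.

Let derive_u_basis x X : O x -> (forall k, 'D_(e k) u x = 0) -> 'D_X u x = 0.
Proof.
move=> Ox Du0; rewrite (derive_basis X (smooth_differentiable su Ox)).
by rewrite big1 // => k _; rewrite [X in _ *: X](Du0 k) scaler0.
Qed.

Let laplacian_u_eq0 x : O x ->
  (forall y, O y -> forall k, 'D_(e k) u y = 0) -> laplacian_u x = 0.
Proof.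
move=> Ox Du0; rewrite /laplacian_u big1 // => i _; rewrite big1 // => j _.
have E : 'D_(e i) ('D_(e j) u) x = 0.
  apply: (etrans (eq_open_derive (e i) oO Ox (fun y Oy => Du0 y Oy j))).
  exact: (derive_cst (0 : R^o) x (e i)).
by rewrite E (derive_u_basis _ Ox (Du0 x Ox)) subrr mulr0.
Qed.

Lemma second_fundamental_form_eq0 x : O x ->
  (forall X Y, second_fundamental_form g G F (cst X) (cst Y) x = 0) <-> H x = 0.
Proof.
move=> Ox; split=> [S0|H0 X Y]; last by rewrite second_fundamental_form_eq // H0 mul0r scale0r.
have e0 : e 0 != 0.
  by apply/eqP => /rowP /(_ 0); rewrite !mxE /= => /eqP; rewrite oner_eq0.
have := S0 (e 0) (e 0); rewrite second_fundamental_form_eq // => /(congr1 (fun z => inner (G (F x)) z (xi x))).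
rewrite innerZl xi1 // inner0l mulr1 => /eqP; rewrite mulf_eq0 => /orP[/eqP //|].
by rewrite gt_eqF // posg.
Qed.

(** * The biharmonic equation on a patch *)

Let w x : R^o := f x * H x.

Lemma smooth_fH : smooth_on O w. Proof. exact: (smoothM oO sf smooth_umbilicity). Qed.

Let derive_u x X : O x -> 'D_X u x = 2 * 'D_X w x.
Proof.
move=> Ox; have dw := smooth_differentiable smooth_fH Ox.
apply: (etrans (deriveMR X (differentiable_cst (2 : R^o) x) dw)).
by rewrite (derive_cst (2 : R^o) x X) mulr0 addr0.
Qed.

(** The second conclusion asks for [H] without zeros on the whole patch: then [w] has zero
    derivative on an open set, the Laplacian term disappears, and the nonzero factor [u x] can be
    divided out. *)
Lemma biharmonic_patch_necessary x : O x ->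
  (forall y, O y -> bitension gbar G F y = 0) ->
  (forall k, H x * 'D_(e k) w x = 0) /\
  ((forall y, O y -> H y != 0) -> ricci G (F x) (xi x) (xi x) = 2 * H x ^+ 2).
Proof.
move=> Ox B0.
have HD y : O y -> forall k, H y * 'D_(e k) w y = 0.
  move=> Oy k; have [/(_ k) + _] := (bitension_eq0 Oy).1 (B0 y Oy).
  by rewrite derive_u // mulrCA => /eqP; rewrite mulf_eq0 pnatr_eq0 => /eqP.
split=> [k|H0]; first exact: HD.
have D0 y : O y -> forall k, 'D_(e k) u y = 0.
  move=> Oy k; have /eqP := HD y Oy k; rewrite mulf_eq0 (negbTE (H0 y Oy)) => /eqP E.
  by rewrite derive_u // E mulr0.
have [_] := (bitension_eq0 Ox).1 (B0 x Ox); rewrite laplacian_u_eq0 //.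
have u0 : u x != 0 by rewrite !mulf_neq0 ?f0 ?H0 // pnatr_eq0.
move: (ricci _ _ _ _) => r E; apply: (mulfI u0).
by apply/eqP; rewrite -subr_eq0 -E; apply/eqP; ring.
Qed.

Lemma biharmonic_patch_sufficient x : O x ->
  (forall y k, O y -> 'D_(e k) w y = 0) ->
  H x = 0 \/ ricci G (F x) (xi x) (xi x) = 2 * H x ^+ 2 ->
  bitension gbar G F x = 0.
Proof.
move=> Ox Dw0 HR.
have D0 y : O y -> forall k, 'D_(e k) u y = 0 by move=> Oy k; rewrite derive_u // Dw0 // mulr0.
apply/(bitension_eq0 Ox); split=> [k|]; first by rewrite D0 // mulr0.
rewrite laplacian_u_eq0 //; case: HR => [H0|->]; last by ring.
by rewrite /u H0; ring.
Qed.

Lemma derive_fH_basis x X : O x -> (forall k, 'D_(e k) w x = 0) -> 'D_X w x = 0.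
Proof.
move=> Ox Dw0; rewrite (derive_basis X (smooth_differentiable smooth_fH Ox)).
by rewrite big1 // => k _; rewrite [X in _ *: X](Dw0 k) scaler0.
Qed.

End LocalSurface.

(** * Charts *)

Section Charts.
Context {R : realType} {m n : nat} {M : manifold R m} {N : manifold R n}.

Lemma near_chart (c : charts M) (p : M) (O : set 'rV[R]_m) :
  chart_dom c p -> open O -> O (chart_map c p) ->
  \near p, chart_dom c p /\ O (chart_map c p).
Proof.
move=> cp oO Op.
have oc := @chart_dom_open R m M c.
have cont : {for p, continuous (chart_map c)}.
  have := @chart_map_continuous R m M c; rewrite continuous_open_subspace //.
  by apply; rewrite inE.
near=> q; split; near: q; first exact: open_nbhs_nbhs.
by apply: cont; exact: open_nbhs_nbhs.
Unshelve. all: by end_near. Qed.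

Lemma open_loc_dom (phi : M -> N) c d : continuous phi -> open (loc_dom phi c d).
Proof.
move=> cphi; rewrite openE => x [p [cp dp] <-].
have oi := @chart_image_open R m M c.
have ix : (chart_map c @` chart_dom c) (chart_map c p) by exists p.
have cont : {for chart_map c p, continuous (chart_inv c)}.
  have := @chart_inv_continuous R m M c; rewrite continuous_open_subspace //.
  by apply; rewrite inE.
have B : nbhs (chart_inv c (chart_map c p)) (phi @^-1` chart_dom d).
  rewrite chart_mapK //; apply: cphi; apply: open_nbhs_nbhs; split=> //; exact: (@chart_dom_open R n N d).
have nB := cont _ B; have nI : nbhs (chart_map c p) (chart_map c @` chart_dom c).
  exact: open_nbhs_nbhs.
apply: filterS (filterI nI nB) => y [[q cq <-]]; rewrite /= chart_mapK // => dq.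
by exists q.
Qed.

Lemma loc_dom_image (phi : M -> N) c d x : loc_dom phi c d x -> (chart_map c @` chart_dom c) x.
Proof. by move=> [p [cp _] <-]; exists p. Qed.

Lemma loc_image (phi : M -> N) c d x : loc_dom phi c d x ->
  (chart_map d @` chart_dom d) (loc phi c d x).
Proof. by move=> [p [cp dp] <-]; exists (phi p) => //; rewrite /loc /= chart_mapK. Qed.

(** Vanishing derivatives make [q] constant on small chart balls, so its level sets are open and
    closed in the connected manifold. *)
Lemma locally_constant (q : M -> R^o) :
  (forall p, exists c (O : set 'rV[R]_m), [/\ chart_dom c p, open O, O (chart_map c p) &
     forall y, O y -> differentiable (q \o chart_inv c) y /\
       forall v, 'D_v (q \o chart_inv c) y = 0]) ->
  forall p p', q p = q p'.
Proof.
move=> qD p p'.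
have near_q r : nbhs r [set s | q s = q r].
  have [c [U [cr oU Ur D]]] := qD r.
  have /nbhs_ballP[b /= b0 bO] : nbhs (chart_map c r) U by exact: open_nbhs_nbhs.
  have K := @derive0_ball_cst R 'rV[R]_m (q \o chart_inv c) (chart_map c r) b
    (fun y By => D y (bO y By)).
  have oB : open_nbhs (chart_map c r) (interior (ball (chart_map c r) b)).
    by split; [exact: open_interior|exact: nbhsx_ballx].
  apply: filterS (near_chart cr oB.1 oB.2) => s [cs /interior_subset Bs].
  by have := K _ Bs; rewrite /= !chart_mapK.
(* Stated for any predicate on the values, so as to cover a level set and its complement at once. *)
have opP (P : R -> Prop) : open [set s | P (q s)].
  rewrite openE => s Ps; apply: filterS (near_q s) => t /= ->; exact: Ps.
have conn := @manifold_connected R m M.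
have : [set s | q s = q p'] = [set: M].
  apply: conn; first by exists p'.
    by exists [set s | q s = q p']; [exact: (opP (fun r => r = q p'))|rewrite setTI].
  exists [set s | q s = q p']; last by rewrite setTI.
  by rewrite -openC; exact: (opP (fun r => ~ (r = q p'))).
by move=> /seteqP[_ /(_ p I)].
Qed.

End Charts.

(** * Totally umbilical surfaces in 3-manifolds *)

Lemma norm_sq_scalar {R : realType} (m : nat) (B A : 'M[R]_m) (a : R) :
  B \in unitmx -> A = a%:M -> norm_sq_op B A = m%:R * a ^+ 2.
Proof.
move=> uB ->; rewrite /norm_sq_op tr_scalar_mx !mul_mx_scalar -scalemxAl mulVmx //.
by rewrite scalerA -expr2 mxtraceZ mxtrace1 mulrC.
Qed.

Lemma grad_eq0 {R : realType} (m : nat) (G : 'rV[R]_m -> 'M[R]_m) (u : 'rV[R]_m -> R) x :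
  G x \in unitmx -> grad G u x = 0 <-> forall k, 'D_(basis_vec k) u x = 0.
Proof.
move=> uG; rewrite /grad; split=> [E k|E].
  have := congr1 (fun z => z *m G x) E; rewrite mulmxKV // mul0mx => /rowP /(_ k).
  by rewrite !mxE.
by rewrite (_ : \row_i _ = 0) ?mul0mx //; apply/rowP => k; rewrite mxE E mxE.
Qed.

Section UmbilicalSurface.
Context {R : realType} {M : manifold R 2} {N : manifold R 3}
    {g : metric_field M} {h : metric_field N} {phi : M -> N}
    {xi : charts N -> M -> 'rV[R]_3} {A : endo_field M} {f : M -> R}.
Hypotheses (hg : riemannian g) (hh : riemannian h)
    (hphi : isometric_immersion g h phi)
    (hxi : unit_normal h phi xi)
    (hA : shape_operator h phi xi A)
    (humb : totally_umbilical A)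
    (hf : smooth_fun f) (fpos : forall p, 0 < f p).

Let H := mean_curvature A.

Lemma umbilical_patch_loc (c : charts M) (d : charts N) :
  umbilical_patch (loc_dom phi c d) (chart_map d @` chart_dom d) (h d) (loc phi c d)
    (xi d \o chart_inv c) (g c) (H \o chart_inv c).
Proof.
have [[cphi sphi] gphi] := hphi; have [sgg _ posg _] := hg; have [sh symh posh _] := hh.
have [[_ sxi] nxi] := hxi; have [_ shA] := hA.
have oO := open_loc_dom (c := c) (d := d) cphi.
split=> //.
- exact: chart_image_open.
- by move=> x Wx; exact: symh.
- by move=> x Wx; exact: posdef_unitmx (posh d x Wx).
- exact: loc_image.
- by apply: smooth_subset (sgg c) => x; exact: loc_dom_image.
- by move=> x Ox; exact: (gphi c d x Ox).2.
- by move=> x Ox; apply: posg; exact: loc_dom_image Ox.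
- by move=> x Ox; exact: (nxi c d x Ox).1.
- by move=> x Ox; exact: (nxi c d x Ox).2.
move=> x Ox X; apply: etrans _ (shA c d x Ox X).
rewrite (humb (loc_dom_image Ox)) -scalemxAl; congr (_ *: _).
by rewrite deriveEjacobian //; exact: smooth_differentiable (sphi c d) Ox.
Qed.

Let unitg c x : (chart_map c @` chart_dom c) x -> g c x \in unitmx.
Proof. by move=> ix; have [_ _ posg _] := hg; exact: posdef_unitmx (posg c x ix). Qed.

Let sf c d : smooth_on (loc_dom phi c d) (f \o chart_inv c : 'rV[R]_2 -> R^o).
Proof.
apply: smooth_subset (hf c) => x; exact: loc_dom_image.
Qed.

Let sw c d := smooth_fH (umbilical_patch_loc c d) (sf c d).
Let w : M -> R^o := fun p => f p * H p.

(** A chart of N around the image point makes results on [loc_dom] available at every point of a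
    chart of M. *)
Let in_loc_dom c p : chart_dom c p -> loc_dom phi c (chart_at (phi p)) (chart_map c p).
Proof. by move=> cp; exists p => //; split=> //; exact: chart_atP. Qed.

Let norm_sq c x : (chart_map c @` chart_dom c) x ->
  norm_sq_op (g c x) (A c x) = 2 * H (chart_inv c x) ^+ 2.
Proof.
move=> ix; apply: norm_sq_scalar; first exact: unitg.
apply/row_matrixP => i; rewrite !rowE (humb ix) -/(H _).
by rewrite mul_mx_scalar.
Qed.

Let normal_equation (c : charts M) (d : charts N) x : loc_dom phi c d x ->
  tangent_part (g c x) (h d (loc phi c d x)) ('J (loc phi c d) x)
    (ricci_op (h d) (loc phi c d x) (xi d (chart_inv c x)))
  = grad (g c) (H \o chart_inv c) x.
Proof. move=> Ox; exact: (ricci_normal_tangent (umbilical_patch_loc c d) Ox). Qed.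

Let derive_w_basis c d y X : loc_dom phi c d y ->
  (forall k, 'D_(basis_vec k) (w \o chart_inv c) y = 0) -> 'D_X (w \o chart_inv c) y = 0.
Proof. exact: (derive_fH_basis (umbilical_patch_loc c d) (sf c d)). Qed.

Let grad_w_constant : (forall c x, (chart_map c @` chart_dom c) x ->
  grad (g c) (w \o chart_inv c) x = 0) -> forall p p', w p = w p'.
Proof.
move=> gw0; apply: locally_constant => p.
pose c := chart_at p; pose d := chart_at (phi p).
exists c, (loc_dom phi c d); split=> [||//|y Oy].
- exact: chart_atP.
- exact: patch_oO (umbilical_patch_loc c d).
- by apply: in_loc_dom; exact: chart_atP.
split; first exact: smooth_differentiable (sw c d) Oy.
move=> X; apply: (derive_w_basis X Oy).
apply/(grad_eq0 _ (unitg (loc_dom_image Oy))); apply: gw0; exact: loc_dom_image Oy.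
Qed.

Let necessary_local : biharmonic (conformal_metric f g) h phi ->
  forall c d x, loc_dom phi c d x ->
  (forall k, H (chart_inv c x) * 'D_(basis_vec k) (w \o chart_inv c) x = 0) /\
  ((forall p, H p != 0) ->
    ricci (h d) (loc phi c d x) (xi d (chart_inv c x)) (xi d (chart_inv c x))
    = 2 * H (chart_inv c x) ^+ 2).
Proof.
move=> bi c d x Ox.
have fp y : loc_dom phi c d y -> 0 < (f \o chart_inv c) y by move=> _; exact: fpos.
have [D0 RE] := biharmonic_patch_necessary (umbilical_patch_loc c d) (sf c d) fp Ox (bi c d).
split; first exact: D0.
by move=> H0; apply: RE => y _; exact: H0.
Qed.

Let w2_constant : biharmonic (conformal_metric f g) h phi -> forall p p', w p * w p = w p' * w p'.
Proof.
move=> bi; apply: (locally_constant (q := fun p => w p * w p)) => p.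
pose c := chart_at p; pose d := chart_at (phi p).
exists c, (loc_dom phi c d); split=> [||//|y Oy].
- exact: chart_atP.
- exact: patch_oO (umbilical_patch_loc c d).
- by apply: in_loc_dom; exact: chart_atP.
have dw : differentiable (w \o chart_inv c) y := smooth_differentiable (sw c d) Oy.
have [D0 _] := necessary_local bi Oy.
split=> [|X]; first exact: (differentiableMR dw dw).
apply: (etrans (deriveMR X dw dw)).
rewrite (derive_basis X dw) big_distrr -big_split big1 //= => k _.
rewrite -mulr2n -[_ *: _]/(_ * _) mulrCA.
(* The derivative of the square contains this product, which is [f] times the vanishing tangential
   equation; the derivative of [w] alone need not vanish at a zero of [H]. *)
have -> : (w \o chart_inv c) y * 'D_(basis_vec k) (w \o chart_inv c) y = 0.
  by rewrite -[(w \o chart_inv c) y]/(f (chart_inv c y) * H (chart_inv c y)) -mulrA D0 mulr0.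
by rewrite mulr0 mul0rn.
Qed.

Let geodesic_H0 : totally_geodesic g h phi <-> forall p, H p = 0.
Proof.
split=> [geo p|H0 c d x Ox].
  pose c := chart_at p; pose d := chart_at (phi p).
  have Op : loc_dom phi c d (chart_map c p) by apply: in_loc_dom; exact: chart_atP.
  have := (second_fundamental_form_eq0 (umbilical_patch_loc c d) Op).1 (geo c d _ Op).
  by rewrite /= chart_mapK //; exact: chart_atP.
apply: (second_fundamental_form_eq0 (umbilical_patch_loc c d) Ox).2; exact: H0.
Qed.

Let case_ii : Prop :=
    [/\ forall p, H p != 0,
        forall (c : charts M) (d : charts N) x, loc_dom phi c d x ->
          tangent_part (g c x) (h d (loc phi c d x)) ('J (loc phi c d) x)
            (ricci_op (h d) (loc phi c d x) (xi d (chart_inv c x)))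
          = grad (g c) (H \o chart_inv c) x,
        forall (c : charts M) (d : charts N) x, loc_dom phi c d x ->
          ricci (h d) (loc phi c d x) (xi d (chart_inv c x)) (xi d (chart_inv c x))
            = norm_sq_op (g c x) (A c x) /\
          norm_sq_op (g c x) (A c x) = 2 * H (chart_inv c x) ^+ 2 &
        forall (c : charts M) x, (chart_map c @` chart_dom c) x ->
          grad (g c) ((fun p => f p * H p) \o chart_inv c) x = 0].

Lemma biharmonic_necessary : biharmonic (conformal_metric f g) h phi ->
  totally_geodesic g h phi \/ case_ii.
Proof.
move=> bi.
have [[p0 Hp0]|nH] := pselect (exists p, H p = 0).
  left; apply/geodesic_H0 => p.
  (* The square of f H is zero at [p0], hence everywhere, and f is positive. *)
  have := w2_constant bi p p0; rewrite {3}/w Hp0 mulr0 mul0r => /eqP.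
  by rewrite mulf_eq0 orbb mulf_eq0 gt_eqF // => /eqP.
have H0 p : H p != 0 by apply/eqP => Hp; apply: nH; exists p.
right; split=> // [c d x Ox|c x ix].
  have [_ RE] := necessary_local bi Ox.
  by rewrite norm_sq ?RE //; exact: loc_dom_image Ox.
apply/(grad_eq0 _ (unitg ix)) => k; have [p cp px] := ix.
have Ox : loc_dom phi c (chart_at (phi p)) x by rewrite -px; exact: in_loc_dom.
have [/(_ k) /eqP + _] := necessary_local bi Ox.
by rewrite mulf_eq0 (negbTE (H0 _)) => /eqP.
Qed.

Lemma biharmonic_sufficient : totally_geodesic g h phi \/ case_ii ->
  biharmonic (conformal_metric f g) h phi.
Proof.
move=> cases c d x Ox.
have fp y : loc_dom phi c d y -> 0 < (f \o chart_inv c) y by move=> _; exact: fpos.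
apply: (biharmonic_patch_sufficient (umbilical_patch_loc c d) (sf c d) fp Ox) => [y k Oy|].
  case: cases => [/geodesic_H0 H0|[_ _ _ gw0]].
    (* On a totally geodesic surface f H is identically zero, whatever [f] is. *)
    have E z : loc_dom phi c d z -> f (chart_inv c z) * H (chart_inv c z) = 0.
      by move=> _; rewrite H0 mulr0.
    apply: (etrans (eq_open_derive (basis_vec k) (patch_oO (umbilical_patch_loc c d)) Oy E)).
    exact: (derive_cst (0 : R^o) y (basis_vec k)).
  by have /(grad_eq0 _ (unitg (loc_dom_image Oy))) := gw0 c y (loc_dom_image Oy); apply.
case: cases => [/geodesic_H0 H0|[_ _ RE _]]; first by left; exact: H0.
by right; have [-> ->] := RE c d x Ox.
Qed.

Lemma conformal_factor : case_ii -> exists2 k : R, 0 < k & forall p, f p = k * `|H p|^-1.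
Proof.
move=> [H0 _ _ gw0]; have wc := grad_w_constant gw0.
(* The definition of a manifold does not exclude the empty one, for which any positive constant
   serves. Otherwise the constant is the absolute value of f H at some point. *)
have [[p0 _]|nM] := pselect (exists p : M, True); last first.
  by exists 1 => // p; case: nM; exists p.
exists `|w p0|; first by rewrite normr_gt0 mulf_neq0 // gt_eqF.
by move=> p; rewrite (wc p0 p) /w normrM gtr0_norm // mulfK // normr_eq0.
Qed.

End UmbilicalSurface.

Theorem theorem2p1 (R : realType) (M : manifold R 2) (N : manifold R 3)
    (g : metric_field M) (h : metric_field N) (phi : M -> N)
    (xi : charts N -> M -> 'rV[R]_3) (A : endo_field M) (f : M -> R)
    (hg : riemannian g) (hh : riemannian h)
    (hphi : isometric_immersion g h phi)
    (hxi : unit_normal h phi xi)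
    (hA : shape_operator h phi xi A)
    (humb : totally_umbilical A)
    (hf : smooth_fun f) (fpos : forall p, 0 < f p) :
  let H := mean_curvature A in
  let normal_equation :=
    forall (c : charts M) (d : charts N) x, loc_dom phi c d x ->
      tangent_part (g c x) (h d (loc phi c d x)) ('J (loc phi c d) x)
        (ricci_op (h d) (loc phi c d x) (xi d (chart_inv c x)))
      = grad (g c) (H \o chart_inv c) x in
  let case_ii :=
    [/\ forall p, H p != 0,
        normal_equation,
        forall (c : charts M) (d : charts N) x, loc_dom phi c d x ->
          ricci (h d) (loc phi c d x) (xi d (chart_inv c x)) (xi d (chart_inv c x))
            = norm_sq_op (g c x) (A c x) /\
          norm_sq_op (g c x) (A c x) = 2 * H (chart_inv c x) ^+ 2 &
        forall (c : charts M) x, (chart_map c @` chart_dom c) x ->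
          grad (g c) ((fun p => f p * H p) \o chart_inv c) x = 0] in
  (biharmonic (conformal_metric f g) h phi <->
     totally_geodesic g h phi \/ case_ii) /\
  (case_ii -> exists2 k : R, 0 < k & forall p, f p = k * `|H p|^-1) /\
  normal_equation.
Proof.
move=> H normal_equation case_ii; split; [split|split].
- exact: biharmonic_necessary.
- exact: biharmonic_sufficient.
- exact: conformal_factor.
- by move=> c d x Ox; exact: (ricci_normal_tangent (umbilical_patch_loc hg hh hphi hxi hA humb c d) Ox).
Qed.
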